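(* Let $\mathbf a\in0\{0,1\}^\infty$ and $\mathbf b\in1\{0,1\}^\infty$, and let $\Omega_{\mathbf a,\mathbf b}=\{i_1i_2\cdots\in\{0,1\}^\infty : i_ni_{n+1}\cdots\le\mathbf a\text{ or } i_ni_{n+1}\cdots\ge\mathbf b\text{ for all }n\ge1\}$. Then: (i) $\Omega_{\mathbf a,\mathbf b}\neq\{\overline{0},\overline{1}\}$ if and only if $\mathbf a\ge\sigma(\overline{0})$ and $\mathbf b\le\sigma(\overline{1})$ for some $\sigma\in\{L,R\}^*M$, or $\mathbf a=\boldsymbol\sigma(\overline{0})$ and $\mathbf b=\boldsymbol\sigma(\overline{1})$ for some primitive $\boldsymbol\sigma\in\{L,R\}^\infty$, or $\mathbf a=0\overline{1}$, or $\mathbf b=1\overline{0}$. (ii) $\Omega_{\mathbf a,\mathbf b}=\{\overline{0},\overline{1}\}$ if and only if ($\mathbf a<\sigma(\overline{0})$ and $\mathbf b\ge\sigma(1\overline{0})$) or ($\mathbf a\le\sigma(0\overline{1})$ and $\mathbf b>\sigma(\overline{1})$) for some $\sigma\in\{L,R\}^*M$. (iii) $\Omega_{\mathbf a,\mathbf b}$ is uncountable with positive entropy if and only if ($\mathbf a\ge\sigma(\overline{0})$ and $\mathbf b<\sigma(1\overline{0})$) or ($\mathbf a>\sigma(0\overline{1})$ and $\mathbf b\le\sigma(\overline{1})$) for some $\sigma\in\{L,M,R\}^*M$. (iv) $\Omega_{\mathbf a,\mathbf b}$ is uncountable with zero entropy if and only if $\mathbf a=\boldsymbol\sigma(\overline{0})$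 and $\mathbf b=\boldsymbol\sigma(\overline{1})$ for some primitive $\boldsymbol\sigma\in\{L,M,R\}^\infty$. (v) $\Omega_{\mathbf a,\mathbf b}$ is countable if and only if ($\mathbf a\le\sigma(01\overline{0})$ and $\mathbf b\ge\sigma(1\overline{0})$) or ($\mathbf a\le\sigma(0\overline{1})$ and $\mathbf b\ge\sigma(10\overline{1})$) for some $\sigma\in\{L,M,R\}^*$.
   Context: Sequences in $\{0,1\}^\infty$ are ordered lexicographically with $0<1$. $\overline{c}$ denotes infinite repetition of the finite word $c$; $0\{0,1\}^\infty$ is the set of sequences starting with $0$, etc. Entropy of a shift-invariant $X\subseteq\{0,1\}^\infty$: $h(X)=\lim_n\frac1n\log A_n(X)$, with $A_n(X)$ the number of distinct length-$n$ blocks occurring in elements of $X$. Substitutions: $L:0\mapsto0,1\mapsto10$; $M:0\mapsto01,1\mapsto10$; $R:0\mapsto01,1\mapsto1$, acting letterwise on finite and infinite words. $S^*$ is the monoid generated by $S$ under composition (including the identity), $S^*M=\{\sigma M:\sigma\in S^*\}$. For $\boldsymbol\sigma=(\sigma_n)_{n\ge1}\in\{L,M,R\}^\infty$ and $\mathbf u\in\{0,1\}^\infty$, $\boldsymbol\sigma(\mathbf u)=\lim_n\sigma_1\cdots\sigma_n(\mathbf u)$. $\boldsymbol\sigma$ is primitive if it does not end with $\overline{L}$ or $\overline{R}$. *)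

(* Defs.v *)
From HB Require Import structures.
From mathcomp Require Import all_boot all_order all_algebra.
From mathcomp Require Import all_classical all_reals all_analysis.
Set Implicit Arguments.
Unset Strict Implicit.
Unset Printing Implicit Defensive.
Import Order.TTheory GRing.Theory Num.Theory.
Import numFieldNormedType.Exports.
Local Open Scope classical_set_scope.

(* The letters 0 and 1 are [false] and [true], and
   sequences are indexed from 0 rather than from 1. *)

(* {0,1}^oo, lexicographically ordered (on [bool], [false < true]) *)
Definition binseq : Type := big_lexi_order (fun _ : nat => bool).
HB.instance Definition _ := Order.Total.on binseq.

Definition shiftseq (k : nat) (u : binseq) : binseq := fun n => u (k + n).

Definition catseq (w : seq bool) (u : binseq) : binseq :=
  fun n => if n < size w then nth false w n else u (n - size w).

(* the infinite repetition of [c] (intended for nonempty [c]) *)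
Definition repseq (c : seq bool) : binseq :=
  fun n => nth false c (n %% size c).

Definition zeros : binseq := repseq [:: false].
Definition ones : binseq := repseq [:: true].

(* A substitution is given by the images of the two letters. *)
Definition subst : Type := bool -> seq bool.

Definition substL : subst :=
  fun c => if c then [:: true; false] else [:: false].
Definition substM : subst :=
  fun c => if c then [:: true; false] else [:: false; true].
Definition substR : subst :=
  fun c => if c then [:: true] else [:: false; true].

Definition act_word (s : subst) (w : seq bool) : seq bool := flatten (map s w).

(* The image of the infinite word s(u_0) s(u_1) s(u_2) ... : for non-erasing
   [s], its letter of index [n] already lies in s(u_0 ... u_n). *)
Definition act (s : subst) (u : binseq) : binseq :=
  fun n => nth false (act_word s (mkseq u n.+1)) n.

Definition subst_id : subst := fun c => [:: c].
Definition subst_comp (s t : subst) : subst := fun c => act_word s (t c).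

Definition comp_list (w : seq subst) : subst := foldr subst_comp subst_id w.

(* the monoid S^* generated by [S] *)
Definition monoid_gen (S : set subst) : set subst :=
  [set comp_list w | w in [set w : seq subst | {in w, forall s, S s}]].

(* S^* t = { s t : s in S^* } *)
Definition monoid_gen_comp (S : set subst) (t : subst) : set subst :=
  [set subst_comp s t | s in monoid_gen S].

(* lim_n s_1 ... s_n (u), in the product topology *)
Definition act_lim (s : nat -> subst) (u : binseq) : binseq :=
  limn (fun n => act (comp_list (mkseq s n)) u : cantor_space).

Definition ends_with (s : nat -> subst) (t : subst) : Prop :=
  exists N, forall n, N <= n -> s n = t.

Definition primitive (s : nat -> subst) : Prop :=
  ~ ends_with s substL /\ ~ ends_with s substR.

Definition Omega (a b : binseq) : set binseq :=
  [set u | forall k, (shiftseq k u <= a)%O \/ (b <= shiftseq k u)%O].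

Definition is_block (X : set binseq) (w : seq bool) : Prop :=
  exists2 u, X u & exists k, w = mkseq (shiftseq k u) (size w).

Definition nb_blocks (X : set binseq) (n : nat) : nat :=
  #|[pred w : n.-tuple bool | `[< is_block X w >]]|.

Definition entropy (R : realType) (X : set binseq) : R :=
  limn (fun n => ln (nb_blocks X n)%:R / n%:R : R)%R.

(* Main.v *)
(* A substitution s in {L, M, R} starts the image of each letter with that letter, hence
   is strictly increasing. If a <= s(01^oo) and b >= s(10^oo), every non-constant element
   of Omega is c^j s(v) with v in the Omega of the desubstituted bounds; iterating this gives
   triviality, countability, and subexponential block counts along a primitive sequence.
   Conversely, the set of u with 0x <= a and 1x >= b for all tails x of u is contained in
   Omega and is mapped by s into the analogous set for s(a), s(b); it is everything for
   a = 01^oo, b = 10^oo. This embeds all of rho({0,1}^oo) in Omega when rho(01^oo) <= a and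
   b <= rho(10^oo), and a Cantor scheme of words in the limit case.
   Each right-hand side thus implies its left-hand side, the left-hand sides exclude each
   other, and the right-hand sides are exhaustive: if (a, b) satisfies none of the finite
   conditions, choosing the next substitution greedily produces an infinite sequence of
   substitutions that must be primitive and have limits a and b. *)
Require Import Defs.
From mathcomp Require Import all_boot all_order all_algebra.
From mathcomp Require Import all_classical all_reals all_analysis.
From mathcomp Require Import zify lra.
Set Implicit Arguments.
Unset Strict Implicit.
Unset Printing Implicit Defensive.
Import Order.TTheory GRing.Theory Num.Theory.
Import numFieldNormedType.Exports.
Local Open Scope classical_set_scope.

(** The greedy step works because the images of the extreme bounds fit together: [L] fixes 10^oo and
    sends 01^oo to (01)^oo = M(0^oo), while [R] fixes 01^oo and sends 10^oo to (10)^oo = M(1^oo).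
    Hence a <= (01)^oo permits the step [L] and b >= (10)^oo permits [R]; in the remaining corner
    either [M] is permitted or a full image already fits between the bounds. Sequences ending in [L]
    or [R] drop out because L^k(1x) tends to 10^oo and R^k(0x) to 01^oo, which pushes [a] or [b]
    onto a boundary covered by a finite condition. Primitivity has two further uses: the word of 0
    stands still only under [L] and that of 1 only under [R], so both grow without bound; and both
    letters can be inserted infinitely often, which gives the branching of the Cantor scheme. The
    delicate desubstitution is that of [M], where a parity argument locates the grid of blocks 01
    and 10. Exchanging the letters swaps [L] and [R], so most statements are proved for one
    alternative only. *)

(** * Lexicographic order, agreement on finitely many letters, and prefixes *)

Definition agree N (u v : binseq) := forall i, i < N -> u i = v i.

Definition pfx (w : seq bool) (u : binseq) := agree (size w) u (nth false w).

Lemma agree_sym N u v : agree N u v -> agree N v u.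
Proof. by move=> uv i iN; rewrite uv. Qed.
Arguments agree_sym {N u v} _.

Lemma agreeW N N' u v : N <= N' -> agree N' u v -> agree N u v.
Proof. by move=> NN' uv i iN; apply: uv; apply: leq_trans NN'. Qed.
Arguments agreeW {N N' u v} _ _.

Lemma seq_lexP (u v : binseq) :
  (u < v)%O <-> exists n, [/\ agree n u v, u n = false & v n = true].
Proof.
rewrite ltNge; have -> : (v <= u)%O =
  if first_diff v u is Some n then (v n <= u n)%O else true by [].
case E : (first_diff v u) => [n|]; split => //.
- move: E => /first_diff_SomeP[vu _]; case vn : (v n); case un : (u n) => // _.
  by exists n; split => // i ni; rewrite vu.
- move=> [m [uv um vm]]; suff : Some n = Some m by case=> ->; rewrite um vm.
  rewrite -E; apply/first_diff_SomeP; split; last by rewrite um vm.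
  by move=> i im; rewrite uv.
- by move=> [m [uv um vm]]; move: E um vm => /first_diff_NoneP -> ->.
Qed.

Lemma lt_agree N (u v u' v' : binseq) : agree N u u' -> agree N v v' ->
  ~ agree N u v -> (u < v)%O -> (u' < v')%O.
Proof.
move=> uu' vv' uv /seq_lexP[n [uvn un vn]]; apply/seq_lexP; exists n.
have nN : n < N.
  by rewrite ltnNge; apply/negP => Nn; apply: uv; apply: agreeW uvn.
split; [|by rewrite -uu'|by rewrite -vv'].
move=> i ni; have iN := ltn_trans ni nN.
by rewrite -uu' // -vv' // uvn.
Qed.

(** The order is closed in the product topology: a strict inequality is decided by finitely many
    letters and would pass to the approximants. All limit arguments on bounds go through this
    form. *)
Lemma le_of_agree (u v : binseq) :
  (forall N, exists x y, [/\ agree N x u, agree N y v & (x <= y)%O]) ->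
  (u <= v)%O.
Proof.
move=> H; rewrite leNgt; apply/negP => /[dup] vu /seq_lexP[n [_ vn un]].
have [x [y [xu yv]]] := H n.+1; apply/negP; rewrite -ltNge.
apply: lt_agree vu; [exact: agree_sym yv|exact: agree_sym xu|].
by move=> /(_ n (ltnSn n)); rewrite un vn.
Qed.

Lemma lt_head (u v : binseq) : u 0 = false -> v 0 = true -> (u < v)%O.
Proof. by move=> u0 v0; apply/seq_lexP; exists 0; split. Qed.

Lemma shiftseqD i j u : shiftseq i (shiftseq j u) = shiftseq (j + i) u.
Proof. by apply/funext => n; rewrite /shiftseq addnA. Qed.

Lemma shiftseq0 u : shiftseq 0 u = u.
Proof. by []. Qed.

Lemma catseq_nil u : catseq [::] u = u.
Proof. by apply/funext => n; rewrite /catseq subn0. Qed.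

Lemma catseq_cat w1 w2 u : catseq (w1 ++ w2) u = catseq w1 (catseq w2 u).
Proof.
apply/funext => n; rewrite /catseq size_cat nth_cat.
case: (ltnP n (size w1)) => h1; first by rewrite ltn_addr.
by rewrite ltn_subLR // subnDA.
Qed.

Lemma catseq_cons c w u : catseq (c :: w) u = catseq [:: c] (catseq w u).
Proof. by rewrite -catseq_cat. Qed.

Lemma catseqS c w u n : catseq (c :: w) u n.+1 = catseq w u n.
Proof. by rewrite /catseq /= ltnS subSS. Qed.

Lemma catseq1E c u : catseq [:: c] u = fun n => if n is n'.+1 then u n' else c.
Proof. by apply/funext => -[|n] //; rewrite catseqS catseq_nil. Qed.

Lemma pfx_catseq w u : pfx w (catseq w u).
Proof. by move=> i iw; rewrite /catseq iw. Qed.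
Arguments pfx_catseq : clear implicits.

Lemma shift_catseq w u : shiftseq (size w) (catseq w u) = u.
Proof.
by apply/funext => n; rewrite /shiftseq /catseq ltnNge leq_addr /= addKn.
Qed.

Lemma shift_catseq_drop i w u : i <= size w ->
  shiftseq i (catseq w u) = catseq (drop i w) u.
Proof.
move=> iw; rewrite -{1}(cat_take_drop i w) catseq_cat.
by rewrite -{1}(size_takel iw) shift_catseq.
Qed.

Lemma pfxP w u : pfx w u -> u = catseq w (shiftseq (size w) u).
Proof.
move=> wu; apply/funext => n; rewrite /catseq; case: ltnP => h.
  exact: wu.
by rewrite /shiftseq subnKC.
Qed.

Lemma pfx_mkseq (u : binseq) n : pfx (mkseq u n) u.
Proof. by move=> i; rewrite size_mkseq => iN; rewrite nth_mkseq. Qed.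
Arguments pfx_mkseq : clear implicits.

Lemma catseq_mkseq (u : binseq) n : u = catseq (mkseq u n) (shiftseq n u).
Proof. by have := pfxP (pfx_mkseq u n); rewrite size_mkseq. Qed.

Lemma pfx_mkseqE w u : pfx w u -> mkseq u (size w) = w.
Proof.
move=> wu; apply: (@eq_from_nth _ false); rewrite size_mkseq // => i iw.
by rewrite nth_mkseq // wu.
Qed.

Lemma agree_mkseq u v n : agree n u v <-> mkseq u n = mkseq v n.
Proof.
split=> [uv|uv i iN].
  apply: (@eq_from_nth _ false); rewrite !size_mkseq // => i iN.
  by rewrite !nth_mkseq // uv.
by rewrite -(nth_mkseq false u iN) uv nth_mkseq.
Qed.

Lemma pfx_cat w1 w2 u : pfx (w1 ++ w2) u -> pfx w1 u.
Proof.
by move=> wu i iw; rewrite wu ?size_cat ?ltn_addr // nth_cat iw.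
Qed.
Arguments pfx_cat {w1 w2 u} _.

Lemma pfx_agree w u v : pfx w u -> pfx w v -> agree (size w) u v.
Proof. by move=> wu wv i iw; rewrite wu // wv. Qed.
Arguments pfx_agree {w u v} _ _.

Lemma agree_catseq N w u v :
  agree N u v -> agree (size w + N) (catseq w u) (catseq w v).
Proof.
move=> uv i iN; rewrite /catseq; case: ltnP => // h.
by apply: uv; rewrite ltn_subLR.
Qed.
Arguments agree_catseq {N} w {u v} _.

Lemma lt_catseq w u v : (u < v)%O -> (catseq w u < catseq w v)%O.
Proof.
move=> /seq_lexP[n [uv un vn]]; apply/seq_lexP; exists (size w + n).
split; first exact: agree_catseq.
  by rewrite /catseq ltnNge leq_addr /= addKn.
by rewrite /catseq ltnNge leq_addr /= addKn.
Qed.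

Lemma lt_catseqE w u v : (catseq w u < catseq w v)%O = (u < v)%O.
Proof.
apply/idP/idP; last exact: lt_catseq.
case: (ltgtP u v) => // [/(lt_catseq w)/lt_trans h /h|->]; by rewrite ltxx.
Qed.

Lemma le_catseq w u v : (catseq w u <= catseq w v)%O = (u <= v)%O.
Proof. by rewrite !leNgt lt_catseqE. Qed.

Lemma catseq_fix_agree w u v : 0 < size w ->
  u = catseq w u -> v = catseq w v -> forall n, agree n u v.
Proof.
move=> w0 uE vE; elim=> [//|n IH]; rewrite uE vE.
apply: (agreeW _ (agree_catseq w IH)); lia.
Qed.
Arguments catseq_fix_agree {w u v} _ _ _ n.

Lemma agreeP u v : (forall n, agree n u v) -> u = v.
Proof. by move=> uv; apply/funext => n; apply: (uv n.+1). Qed.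

(** Prepending a nonempty word is a contraction, so it has at most one fixed point. Identities
    between periodic sequences are reduced to this. *)
Lemma catseq_fix w u v : 0 < size w ->
  u = catseq w u -> v = catseq w v -> u = v.
Proof. by move=> w0 uE vE; apply/agreeP; exact: catseq_fix_agree vE. Qed.

Lemma zerosE n : zeros n = false.
Proof. by rewrite /zeros /repseq modn1. Qed.

Lemma onesE n : ones n = true.
Proof. by rewrite /ones /repseq modn1. Qed.

Lemma zeros_cons : zeros = catseq [:: false] zeros.
Proof. by rewrite catseq1E; apply/funext => -[|n]; rewrite !zerosE. Qed.

Lemma ones_cons : ones = catseq [:: true] ones.
Proof. by rewrite catseq1E; apply/funext => -[|n]; rewrite !onesE. Qed.

Lemma zeros_le u : (zeros <= u)%O.
Proof.
by rewrite leNgt; apply/negP => /seq_lexP[n [_ _]]; rewrite zerosE.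
Qed.

Lemma le_ones u : (u <= ones)%O.
Proof.
by rewrite leNgt; apply/negP => /seq_lexP[n [_]]; rewrite onesE.
Qed.

Lemma le_head0 (u : binseq) : u 0 = false -> (u <= catseq [:: false] ones)%O.
Proof.
move=> u0; rewrite (@pfxP [:: false] u); last by case.
by rewrite le_catseq le_ones.
Qed.

Lemma ge_head1 (u : binseq) : u 0 = true -> (catseq [:: true] zeros <= u)%O.
Proof.
move=> u0; rewrite (@pfxP [:: true] u); last by case.
by rewrite le_catseq zeros_le.
Qed.

(** * Substitutions *)

(** Besides monotonicity this makes [s] non-erasing, so that the first n+1 letters determine letter
    n of the image, as the definition of [act] presupposes. *)
Definition head_preserving (s : subst) := forall c, exists w, s c = c :: w.

Lemma act_word_cat s w1 w2 : act_word s (w1 ++ w2) = act_word s w1 ++ act_word s w2.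
Proof. by rewrite /act_word map_cat flatten_cat. Qed.

Lemma act_word_cons s c w : act_word s (c :: w) = s c ++ act_word s w.
Proof. by []. Qed.

Lemma act_word1 s c : act_word s [:: c] = s c.
Proof. by rewrite /act_word /= cats0. Qed.

Lemma act_word_comp s t w :
  act_word (subst_comp s t) w = act_word s (act_word t w).
Proof. by elim: w => //= c w IH; rewrite !act_word_cons act_word_cat IH. Qed.

Section HeadPreserving.
Variables (s : subst) (sP : head_preserving s).

Lemma hp_size c : 0 < size (s c).
Proof. by case: (sP c) => w ->. Qed.

Lemma size_act_word w : size w <= size (act_word s w).
Proof.
elim: w => //= c w IH; rewrite act_word_cons size_cat.
by have := hp_size c; lia.
Qed.

Lemma act_nth u n i : i < size (act_word s (mkseq u n)) ->
  act s u i = nth false (act_word s (mkseq u n)) i.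
Proof.
have pre m k j : j < size (act_word s (mkseq u m)) ->
  nth false (act_word s (mkseq u (m + k))) j = nth false (act_word s (mkseq u m)) j.
  by move=> h; rewrite /mkseq iotaD map_cat act_word_cat nth_cat h.
move=> h; rewrite /act; have h' : i < size (act_word s (mkseq u i.+1)).
  by have := size_act_word (mkseq u i.+1); rewrite size_mkseq.
by case: (leqP n i.+1) => [/subnKC <-|/ltnW /subnKC <-]; rewrite pre.
Qed.

Lemma act_catseq w u : act s (catseq w u) = catseq (act_word s w) (act s u).
Proof.
have mkE m : mkseq (catseq w u) (size w + m) = w ++ mkseq u m.
  rewrite /mkseq iotaD map_cat; congr cat.
    by rewrite -/(mkseq _ _) pfx_mkseqE //; exact: pfx_catseq.
  apply: (@eq_from_nth _ false); rewrite !size_map !size_iota // => i im.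
  rewrite !(nth_map 0) ?size_iota // !nth_iota // !add0n.
  by rewrite /catseq ltnNge leq_addr /= addKn.
apply/funext => i; rewrite (@act_nth _ (size w + i.+1)) mkE act_word_cat; last first.
  rewrite size_cat; have := size_act_word (mkseq u i.+1); rewrite size_mkseq; lia.
rewrite nth_cat /catseq; case: ltnP => // h; rewrite (@act_nth u i.+1) //.
have := size_act_word (mkseq u i.+1); rewrite size_mkseq; lia.
Qed.

Lemma act_cons c u : act s (catseq [:: c] u) = catseq (s c) (act s u).
Proof. by rewrite act_catseq act_word1. Qed.

Lemma act_pfx w u : pfx w u -> pfx (act_word s w) (act s u).
Proof. by move=> /pfxP ->; rewrite act_catseq; exact: pfx_catseq. Qed.

Lemma act_unfold u : act s u = catseq (s (u 0)) (act s (shiftseq 1 u)).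
Proof. by rewrite {1}(catseq_mkseq u 1) act_cons. Qed.

Lemma act_head u : act s u 0 = u 0.
Proof. by rewrite act_unfold; case: (sP (u 0)) => w ->. Qed.

Lemma act_lt u v : (u < v)%O -> (act s u < act s v)%O.
Proof.
move=> /seq_lexP[n [uv un vn]].
rewrite (catseq_mkseq u n) (catseq_mkseq v n).
rewrite (agree_mkseq u v n).1 // !act_catseq; apply: lt_catseq.
by apply: lt_head; rewrite act_head /shiftseq addn0.
Qed.

Lemma act_ltE u v : (act s u < act s v)%O = (u < v)%O.
Proof.
apply/idP/idP; last exact: act_lt.
case: (ltgtP u v) => // [/act_lt/lt_trans h /h|->]; by rewrite ltxx.
Qed.

Lemma act_leE u v : (act s u <= act s v)%O = (u <= v)%O.
Proof. by rewrite !leNgt act_ltE. Qed.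

Lemma act_inj : injective (act s).
Proof.
by move=> u v uv; apply/eqP; rewrite eq_le -(act_leE u v) -(act_leE v u) uv lexx.
Qed.

(** Position j of the image falls inside the image of some letter [u k], at offset i. Conditions on
    all tails of an image thus reduce to tails of [u] and finitely many offsets. *)
Lemma shift_act u j : exists k i, i < size (s (u k)) /\
  shiftseq j (act s u) = catseq (drop i (s (u k))) (act s (shiftseq k.+1 u)).
Proof.
elim: j => [|j [k [i [ik E]]]].
  by exists 0, 0; rewrite hp_size drop0 shiftseq0 act_unfold.
rewrite -addn1 -shiftseqD E; case: (ltnP i.+1 (size (s (u k)))) => h.
  exists k, i.+1; split => //.
  by rewrite shift_catseq_drop ?size_drop ?drop_drop ?add1n //; lia.
exists k.+1, 0; rewrite hp_size drop0; split=> //.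
have -> : 1 = size (drop i (s (u k))) by rewrite size_drop; lia.
by rewrite shift_catseq act_unfold shiftseqD /shiftseq addn0 addn1.
Qed.

Lemma act_agree N u v : agree N u v -> agree N (act s u) (act s v).
Proof.
by move=> uv i iN; rewrite /act (agree_mkseq u v i.+1).1 //; apply: agreeW uv.
Qed.

End HeadPreserving.
Arguments act_pfx {s} sP {w u} _.
Arguments act_agree s {N u v} _.

Lemma hp_comp s t : head_preserving s -> head_preserving t ->
  head_preserving (subst_comp s t).
Proof.
move=> sP tP c; rewrite /subst_comp; case: (tP c) => w ->.
by rewrite act_word_cons; case: (sP c) => v ->; eexists.
Qed.

Lemma act_comp s t u : head_preserving s -> head_preserving t ->
  act (subst_comp s t) u = act s (act t u).
Proof.
move=> sP tP; apply/funext => i; have cP := hp_comp sP tP.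
have wu := pfx_mkseq u i.+1; set w := mkseq u i.+1 in wu.
have sz : i < size (act_word (subst_comp s t) w).
  by have := size_act_word cP w; rewrite {1}size_mkseq.
rewrite (act_pfx cP wu) // (act_pfx sP (act_pfx tP wu)) -act_word_comp //.
Qed.

Lemma act_id u : act subst_id u = u.
Proof.
apply/funext => i; rewrite /act /act_word.
have -> : [seq subst_id c | c <- mkseq u i.+1] = [seq [:: c] | c <- mkseq u i.+1] by [].
by rewrite flatten_seq1 nth_mkseq.
Qed.

Lemma hp_id : head_preserving subst_id.
Proof. by move=> c; exists [::]. Qed.

Lemma hp_L : head_preserving substL. Proof. by case; eexists. Qed.
Lemma hp_M : head_preserving substM. Proof. by case; eexists. Qed.
Lemma hp_R : head_preserving substR. Proof. by case; eexists. Qed.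

Definition LMR : set subst := [set substL; substM; substR].
Definition LR : set subst := [set substL; substR].

Lemma LR_LMR s : LR s -> LMR s.
Proof. by move=> [->|->]; [left; left|right]. Qed.

Lemma hp_LMR s : LMR s -> head_preserving s.
Proof. by move=> [[->|->]|->]; [exact: hp_L|exact: hp_M|exact: hp_R]. Qed.

Definition allin (S : set subst) (w : seq subst) := {in w, forall s, S s}.

Lemma allin_cons S s w : allin S (s :: w) <-> S s /\ allin S w.
Proof.
split=> [h|[sS wS] t].
  by split=> [|t tw]; apply: h; rewrite in_cons ?eqxx ?tw ?orbT.
by rewrite in_cons => /predU1P[->|/wS].
Qed.

Lemma allin_rcons S w s : allin S w -> S s -> allin S (rcons w s).
Proof. by move=> wS sS t; rewrite mem_rcons in_cons => /predU1P[->|/wS]. Qed.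

Lemma hp_list w : allin LMR w -> head_preserving (comp_list w).
Proof.
elim: w => [_|s w IH /allin_cons[sS wS]]; first exact: hp_id.
by apply: hp_comp; [exact: hp_LMR|exact: IH].
Qed.

Lemma act_word_id w : act_word subst_id w = w.
Proof. exact: flatten_seq1. Qed.

Lemma act_word_list_cat w1 w2 v : act_word (comp_list (w1 ++ w2)) v =
  act_word (comp_list w1) (act_word (comp_list w2) v).
Proof.
elim: w1 => /= [|s w1 IH]; first by rewrite act_word_id.
by rewrite !act_word_comp IH.
Qed.

Lemma comp_list_catE w1 w2 : comp_list (w1 ++ w2) = subst_comp (comp_list w1) (comp_list w2).
Proof.
apply/funext => c.
by rewrite -[LHS]act_word1 act_word_list_cat act_word1.
Qed.

Lemma comp_list_rcons w s : comp_list (rcons w s) = subst_comp (comp_list w) s.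
Proof.
rewrite -cats1 comp_list_catE; apply/funext => c.
rewrite /subst_comp /= /subst_comp /=.
by have -> : subst_id = (fun c => [:: c]) by []; rewrite act_word1.
Qed.

Lemma act_rcons w s u : allin LMR w -> LMR s ->
  act (comp_list (rcons w s)) u = act (comp_list w) (act s u).
Proof.
move=> wS sS; rewrite comp_list_rcons act_comp //; first exact: hp_list.
exact: hp_LMR.
Qed.

Definition hi0 : binseq := catseq [:: false] ones.
Definition lo1 : binseq := catseq [:: true] zeros.

Lemma actL_zeros : act substL zeros = zeros.
Proof.
apply: (@catseq_fix [:: false]) => //; last exact: zeros_cons.
by rewrite {1}zeros_cons (act_cons hp_L).
Qed.

Lemma actR_ones : act substR ones = ones.
Proof.
apply: (@catseq_fix [:: true]) => //; last exact: ones_cons.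
by rewrite {1}ones_cons (act_cons hp_R).
Qed.

Lemma actM_zeros_cons : act substM zeros = catseq [:: false; true] (act substM zeros).
Proof. by rewrite {1}zeros_cons (act_cons hp_M). Qed.

Lemma actM_ones_cons : act substM ones = catseq [:: true; false] (act substM ones).
Proof. by rewrite {1}ones_cons (act_cons hp_M). Qed.

Lemma actL_ones : act substL ones = act substM ones.
Proof.
apply: (@catseq_fix [:: true; false]) => //; last exact: actM_ones_cons.
by rewrite {1}ones_cons (act_cons hp_L).
Qed.

Lemma actR_zeros : act substR zeros = act substM zeros.
Proof.
apply: (@catseq_fix [:: false; true]) => //; last exact: actM_zeros_cons.
by rewrite {1}zeros_cons (act_cons hp_R).
Qed.

Lemma actM_zeros1 : act substM zeros = catseq [:: false] (act substM ones).
Proof.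
apply/esym/(@catseq_fix [:: false; true]) => //; last exact: actM_zeros_cons.
by rewrite {1}actM_ones_cons -!catseq_cat.
Qed.

Lemma actM_ones1 : act substM ones = catseq [:: true] (act substM zeros).
Proof. by rewrite actM_zeros1 -catseq_cat -actM_ones_cons. Qed.

Lemma actL_lo1 : act substL lo1 = lo1.
Proof.
by rewrite /lo1 (act_cons hp_L) actL_zeros {2}zeros_cons -catseq_cat.
Qed.

Lemma actR_hi0 : act substR hi0 = hi0.
Proof.
by rewrite /hi0 (act_cons hp_R) actR_ones {2}ones_cons -catseq_cat.
Qed.

Lemma actL_hi0 : act substL hi0 = act substM zeros.
Proof. by rewrite /hi0 (act_cons hp_L) actL_ones actM_zeros1. Qed.

Lemma actR_lo1 : act substR lo1 = act substM ones.
Proof. by rewrite /lo1 (act_cons hp_R) actR_zeros actM_ones1. Qed.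

(** Both sides are 10(01)^oo. A bound stated with [M] can thereby be read as a bound after one step
    [L]. *)
Lemma actM_lo1 : act substM lo1 = act substL (catseq [:: true; false] ones).
Proof.
rewrite /lo1 (act_cons hp_M) (act_catseq hp_L) actL_ones.
by rewrite actM_zeros1 -catseq_cat.
Qed.

Lemma actM_hi0 : act substM hi0 = act substR (catseq [:: false; true] zeros).
Proof.
rewrite /hi0 (act_cons hp_M) (act_catseq hp_R) actR_zeros.
by rewrite actM_ones1 -catseq_cat.
Qed.

(** * Exchanging the letters *)

(** This reverses the order and carries [Omega a b] into [Omega (flip b) (flip a)]. Conjugation by
    it swaps [substL] with [substR] and fixes [substM]. *)
Definition flip (u : binseq) : binseq := fun n => ~~ u n.
Definition flip_subst (s : subst) : subst := fun c => map negb (s (~~ c)).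

Lemma flipK : involutive flip.
Proof. by move=> u; apply/funext => n; rewrite /flip negbK. Qed.

Lemma flip_lt u v : (flip u < flip v)%O = (v < u)%O.
Proof.
have h x y : (x < y)%O -> (flip y < flip x)%O.
  move=> /seq_lexP[n [xy xn yn]]; apply/seq_lexP; exists n.
  by split; rewrite /flip ?xn ?yn // => i ni; rewrite xy.
by apply/idP/idP => /h //; rewrite !flipK.
Qed.

Lemma flip_le u v : (flip u <= flip v)%O = (v <= u)%O.
Proof. by rewrite !leNgt flip_lt. Qed.

Lemma flip_catseq w u : flip (catseq w u) = catseq (map negb w) (flip u).
Proof.
apply/funext => n; rewrite /flip /catseq size_map; case: ltnP => // h.
by rewrite (nth_map false).
Qed.

Lemma flip_zeros : flip zeros = ones.
Proof. by apply/funext => n; rewrite /flip zerosE onesE. Qed.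

Lemma flip_ones : flip ones = zeros.
Proof. by rewrite -flip_zeros flipK. Qed.

Lemma flip_shift k u : flip (shiftseq k u) = shiftseq k (flip u).
Proof. by []. Qed.

Lemma act_flip_subst s u : head_preserving s ->
  act (flip_subst s) (flip u) = flip (act s u).
Proof.
move=> sP; have aw w : act_word (flip_subst s) (map negb w) = map negb (act_word s w).
  elim: w => //= c w IH; rewrite !act_word_cons map_cat IH.
  by rewrite /flip_subst negbK.
apply/funext => n; rewrite /flip /act.
have -> : mkseq (fun n => ~~ u n) n.+1 = map negb (mkseq u n.+1).
  by rewrite /mkseq -map_comp.
rewrite aw (nth_map false) //.
by have := size_act_word sP (mkseq u n.+1); rewrite size_mkseq.
Qed.

Lemma flip_substL : flip_subst substL = substR.
Proof. by apply/funext => -[]. Qed.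

Lemma flip_substR : flip_subst substR = substL.
Proof. by apply/funext => -[]. Qed.

Lemma flip_substM : flip_subst substM = substM.
Proof. by apply/funext => -[]. Qed.

Lemma flip_hi0 : flip hi0 = lo1.
Proof. by rewrite /hi0 flip_catseq flip_ones. Qed.

Lemma flip_lo1 : flip lo1 = hi0.
Proof. by rewrite -flip_hi0 flipK. Qed.

Lemma LMR_flip s : LMR s -> LMR (flip_subst s).
Proof.
move=> [[->|->]|->]; rewrite ?flip_substL ?flip_substM ?flip_substR.
- by right.
- by left; right.
- by left; left.
Qed.

Lemma LR_flip s : LR s -> LR (flip_subst s).
Proof.
by move=> [->|->]; rewrite ?flip_substL ?flip_substR; [right|left].
Qed.

Lemma allin_LR w : allin LR w -> allin LMR w.
Proof. by move=> h s sw; apply: LR_LMR; exact: h. Qed.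

Lemma allin_flip (S : set subst) w : (forall s, S s -> S (flip_subst s)) ->
  allin S w -> allin S (map flip_subst w).
Proof. by move=> h wS _ /mapP[s sw ->]; apply: h; exact: wS. Qed.

Lemma act_flip_list w u : allin LMR w ->
  act (comp_list (map flip_subst w)) (flip u) = flip (act (comp_list w) u).
Proof.
elim: w u => [u _|s w IH u /allin_cons[sS wS]]; first by rewrite !act_id.
have wP := hp_list wS.
have wP' := hp_list (allin_flip LMR_flip wS).
have sP := hp_LMR sS; have sP' := hp_LMR (LMR_flip sS).
by rewrite /= !act_comp // IH // act_flip_subst.
Qed.

(** * Admissible sequences and desubstitution *)

(* [Omega] with the two order conditions replaced by arbitrary predicates: this
   generality makes desubstitution exact, [P] becoming [P \o act s]. *)
Definition OmPQ (P Q : set binseq) : set binseq :=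
  [set u | forall k, if u k then Q (shiftseq k u) else P (shiftseq k u)].

(** Since [a] starts with 0 and [b] with 1, the first letter of a tail decides which of the two
    inequalities can hold. *)
Lemma Omega_OmPQ (a b : binseq) : a 0 = false -> b 0 = true ->
  Omega a b = OmPQ [set x | (x <= a)%O] [set x | (b <= x)%O].
Proof.
move=> a0 b0; apply/seteqP; split => u uO k.
  case uk : (u k); case: (uO k) => // h; exfalso; move: h; apply/negP.
    by rewrite -ltNge; apply: lt_head => //; rewrite /shiftseq addn0.
  by rewrite -ltNge; apply: lt_head => //; rewrite /shiftseq addn0.
by have := uO k; case: (u k); [right|left].
Qed.

Lemma OmPQ_shift P Q u k : OmPQ P Q u -> OmPQ P Q (shiftseq k u).
Proof. by move=> uO i; rewrite shiftseqD; exact: (uO (k + i)). Qed.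

(** Only the positions where the image of a letter starts are tested; there the letter of the image
    is the letter of [v] itself. *)
Lemma OmPQ_act P Q s w v : head_preserving s ->
  OmPQ P Q (catseq w (act s v)) -> OmPQ (act s @^-1` P) (act s @^-1` Q) v.
Proof.
move=> sP uO k; have := uO (size (w ++ act_word s (mkseq v k))).
set u := catseq w _; have uE : u = catseq (w ++ act_word s (mkseq v k)) (act s (shiftseq k v)).
  by rewrite catseq_cat -act_catseq // -catseq_mkseq.
have -> : u (size (w ++ act_word s (mkseq v k))) = v k.
  rewrite uE -[X in catseq _ _ X]addn0 -/(shiftseq _ _ _) shift_catseq act_head //.
  by rewrite /shiftseq addn0.
by rewrite uE shift_catseq.
Qed.

Lemma OmPQ_flip P Q u : OmPQ P Q u -> OmPQ (flip @^-1` Q) (flip @^-1` P) (flip u).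
Proof.
move=> uO k; have := uO k; have -> : flip u k = ~~ u k by [].
have e : flip (shiftseq k (flip u)) = shiftseq k u by rewrite flip_shift flipK.
by case: (u k) => /= h; [change (Q (flip (shiftseq k (flip u))))|
  change (P (flip (shiftseq k (flip u))))]; rewrite e.
Qed.

Lemma parse s (G : set binseq) x : head_preserving s ->
  (forall y, G y -> pfx (s (y 0)) y /\ G (shiftseq (size (s (y 0))) y)) ->
  G x -> exists v, x = act s v.
Proof.
move=> sP GP Gx; pose next (y : binseq) := shiftseq (size (s (y 0))) y.
pose v : binseq := fun k => iter k next x 0; exists v.
have H n : G (iter n next x) /\ x = catseq (act_word s (mkseq v n)) (iter n next x).
  elim: n => [|n [Gn xE]]; first by rewrite catseq_nil.
  have [/pfxP pn Gn'] := GP _ Gn; split=> //.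
  rewrite mkseqS -cats1 act_word_cat catseq_cat act_word1 {1}xE; congr catseq; exact: pn.
apply/agreeP => n; have [_ xE] := H n.
have sz := size_act_word sP (mkseq v n); rewrite size_mkseq in sz.
apply: (agreeW sz); apply: (pfx_agree _ (act_pfx sP (pfx_mkseq v n))).
by rewrite {1}xE; exact: pfx_catseq.
Qed.

Lemma first_change c (u : binseq) : (forall n, u n = c) \/
  exists j, u = catseq (nseq j c) (shiftseq j u) /\ u j = ~~ c.
Proof.
case: (pselect (forall n, u n = c)) => [|/existsNP[i ui]]; first by left.
right; have ex : exists i, u i != c by exists i; apply/eqP.
case: (ex_minnP ex) => j uj jmin; exists j; split; last by case: (u j) c uj {ui ex jmin} => [] [].
rewrite -{2}(size_nseq j c); apply: pfxP => k; rewrite size_nseq => kj.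
rewrite nth_nseq kj; apply/eqP; apply: contraTT kj => /jmin; by rewrite -leqNgt.
Qed.

Lemma actM_zerosE n : act substM zeros n = odd n.
Proof.
suff -> : act substM zeros = (fun n => odd n) :> binseq by [].
apply: (@catseq_fix [:: false; true]) => //; first exact: actM_zeros_cons.
rewrite catseq_cons !catseq1E; apply/funext => -[|[|k]] //=.
by rewrite negbK.
Qed.

(** The bound is (01)^oo, which forbids 011. After an initial run of 1s no two 1s are adjacent, and
    the sequence splits into blocks 0 and 10. *)
Lemma desubstL P Q u : (forall x, P x -> (x <= act substL hi0)%O) ->
  OmPQ P Q u ->
  u = ones \/ exists j v, u = catseq (nseq j true) (act substL v).
Proof.
move=> PL uO.
have no011 k : u k = false -> u k.+1 -> u k.+2 -> False.
  move=> uk uk1 uk2; have := uO k; rewrite uk => /PL.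
  apply/negP; rewrite -ltNge; apply/seq_lexP; exists 2.
  rewrite actL_hi0 actM_zerosE /shiftseq addn2 uk2; split => // i.
  by rewrite actM_zerosE; case: i => [|[|//]] _; rewrite ?addn0 ?addn1 ?uk ?uk1.
have [u1|[i [uE ui]]] := first_change true u.
  by left; apply/funext => n; rewrite onesE u1.
(* The last 1 of the initial run belongs to the first block 10, so it is not counted in the prefix;
   for [i = 0] the truncated predecessor is the right value as well. *)
right; pose j := i.-1.
have uE' : u = catseq (nseq j true) (shiftseq j u).
  have /pfxP : pfx (nseq j true) u.
    move=> k; rewrite size_nseq => kj; rewrite uE /catseq size_nseq !nth_nseq kj.
    by have -> : k < i by rewrite /j in kj; lia.
  by rewrite size_nseq.
have G0 n : ~~ (u (j + n) && u (j + n).+1).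
  elim: n => [|n IH].
    rewrite addn0 /j; move: ui; clear; case: i => [|i] /= ->; by rewrite ?andbF.
  apply/negP => /andP[h1 h2]; rewrite addnS in h1 h2.
  apply: (@no011 (j + n)) => //; apply/negbTE.
  by move: IH; rewrite h1 andbT.
have [] := @parse substL [set x | forall n, ~~ (x n && x n.+1)] (shiftseq j u) hp_L.
- move=> y Gy; split; last by move=> n; rewrite /shiftseq addnS; exact: Gy.
  have := Gy 0; case y0 : (y 0) => /=; last by move=> _ [].
  by move=> /negbTE y1 [|[|]].
- by move=> n; rewrite /shiftseq addnS; exact: G0.
by move=> v xE; exists j, v; rewrite -xE.
Qed.

Lemma map_negb_nseq j c : map negb (nseq j c) = nseq j (~~ c).
Proof. by rewrite map_nseq. Qed.

Lemma desubstR P Q u : (forall x, Q x -> (act substR lo1 <= x)%O) ->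
  OmPQ P Q u ->
  u = zeros \/ exists j v, u = catseq (nseq j false) (act substR v).
Proof.
move=> QR /OmPQ_flip/desubstL[|/(congr1 flip)|[j [v /(congr1 flip)]]].
- move=> x /QR; rewrite -flip_le flipK -(act_flip_subst _ hp_R).
  by rewrite flip_substR flip_lo1.
- by rewrite flipK flip_ones; left.
- rewrite flipK flip_catseq map_negb_nseq -(act_flip_subst _ hp_L) flip_substL => ->.
  by right; exists j, (flip v).
Qed.

Lemma no_odd_double P Q d u k m :
  (forall x, P x -> (x <= act substM hi0)%O) ->
  (forall x, Q x -> (act substM lo1 <= x)%O) -> OmPQ P Q u ->
  u k = ~~ d -> u k.+1 = d -> u k.+2 = d -> ~~ odd m ->
  (forall i, i < m -> u (k.+2 + i) = ~~ u (k.+2 + i.+1)) ->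
  u (k.+2 + m) != u (k.+2 + m.+1).
Proof.
wlog -> : P Q d u / d = false => [W PM QM uO|].
  case: d => [u0 u1 u2 mE alt|]; last exact: W PM QM uO.
  have := W (flip @^-1` Q) (flip @^-1` P) false (flip u) erefl _ _ (OmPQ_flip uO).
  rewrite /flip u0 u1 u2 (inj_eq negb_inj); apply => // [x /QM|x /PM|i im]; last by rewrite alt.
    by rewrite -flip_le flipK -(act_flip_subst _ hp_M) flip_substM flip_lo1.
  by rewrite -flip_le flipK -(act_flip_subst _ hp_M) flip_substM flip_hi0.
move=> PM QM uO u0 u1 u2 mE alt; have altE i : i <= m -> u (k.+2 + i) = odd i.
  elim: i => [|i IH] im; first by rewrite addn0 u2.
  by have := alt _ im; rewrite IH ?(ltnW im) //= => ->; rewrite negbK.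
apply/negP => /eqP um; have := uO k; rewrite u0 => /QM; apply/negP; rewrite -ltNge.
apply/seq_lexP; exists m.+3.
have loE n : act substM lo1 n.+2 = odd n.
  by rewrite /lo1 (act_cons hp_M) !catseqS catseq_nil actM_zerosE.
have shE n : shiftseq k u n.+2 = u (k.+2 + n) by rewrite /shiftseq !addnS !addSn.
split; last by rewrite loE.
- move=> [|[|i]] im; rewrite ?loE ?shE ?altE //.
    by rewrite /shiftseq addn0 u0.
  by rewrite /shiftseq addn1 u1.
- by rewrite shE -um altE // (negbTE mE).
Qed.

(** Two repetitions at odd distance would yield two consecutive ones at odd distance, which
    [no_odd_double] excludes. Consequently pairs of adjacent letters cut on the other parity are all
    01 or 10. *)
Lemma doubles_same_parity P Q x :
  (forall y, P y -> (y <= act substM hi0)%O) ->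
  (forall y, Q y -> (act substM lo1 <= y)%O) -> OmPQ P Q x -> x 0 != x 1 ->
  forall q p, p < q -> x p = x p.+1 -> x q = x q.+1 -> ~~ odd (q - p).
Proof.
move=> PM QM xO x01; elim/ltn_ind => q IH p pq xp xq; apply/negP => opq.
have ex : exists p, (p < q) && (x p == x p.+1) by exists p; rewrite pq xp eqxx.
have bd p' : (p' < q) && (x p' == x p'.+1) -> p' <= q by case/andP => /ltnW.
case: (ex_maxnP ex bd) => r /andP[rq /eqP xr] rmax.
have pr : p <= r by apply: rmax; rewrite pq xp eqxx.
have oqr : odd (q - r).
  move: pr; rewrite leq_eqVlt => /predU1P[<- //|pr].
  by have := IH r rq p pr xp xr; move: opq; lia.
(* The last repetition [r] before [q] is not at 0, since the first two letters differ; and the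
   letter before it differs from it, since otherwise two repetitions would be at distance 1. *)
case: r => [|r] in rq xr rmax pr oqr *; first by rewrite xr eqxx in x01.
have xr1 : x r != x r.+1.
  apply/negP => /eqP e; have := IH r.+1 rq r (ltnSn r) e xr.
  by rewrite subSnn.
have : x (r.+2 + (q - r.+2)) != x (r.+2 + (q - r.+2).+1).
  apply: (@no_odd_double P Q (x r.+1)) => //.
  - by move: xr1; case: (x r); case: (x r.+1).
  - by move: oqr rq; clear; lia.
  - move=> i im; have : ~~ (x (r.+2 + i) == x (r.+2 + i).+1).
      apply/negP => e; have := rmax (r.+2 + i); rewrite e andbT.
      have -> : r.+2 + i < q by move: im rq; clear; lia.
      by move=> /(_ isT); clear; lia.
    by rewrite addnS; case: (x _); case: (x _).
have -> : r.+2 + (q - r.+2) = q by move: rq; clear; lia.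
by rewrite addnS subnKC ?xq ?eqxx.
Qed.

(** The sequence is cut so that one letter of the initial run is left. If no repetition sits at an
    even position, it is parsed from there. *)
Lemma desubstM P Q u :
  (forall x, P x -> (x <= act substM hi0)%O) ->
  (forall x, Q x -> (act substM lo1 <= x)%O) -> OmPQ P Q u ->
  [\/ u = zeros, u = ones |
    exists c j v, u = catseq (nseq j c) (act substM v)].
Proof.
move=> PM QM uO.
have [uc|[i [uE ui]]] := first_change (u 0) u.
  case u0 : (u 0); [apply: Or32|apply: Or31]; apply/funext => n.
    by rewrite onesE uc u0.
  by rewrite zerosE uc u0.
apply: Or33; exists (u 0).
case: i => [|j] in uE ui *; first by move: ui; case: (u 0).
have uj k : k <= j -> u k = u 0.
  by move=> kj; rewrite uE /catseq size_nseq ltnS kj nth_nseq ltnS kj.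
pose x := shiftseq j u; have xO : OmPQ P Q x by exact: OmPQ_shift.
have x01 : x 0 != x 1 by rewrite /x /shiftseq addn0 addn1 ui uj //; case: (u 0).
have par := doubles_same_parity PM QM xO x01.
pose G := [set y : binseq | forall i, y (2 * i) != y (2 * i).+1].
have parseG y : G y -> exists v, y = act substM v.
  apply: parse hp_M _ => {}y Gy; have -> : size (substM (y 0)) = 2 by case: (y 0).
  split; last by move=> i; have := Gy i.+1; rewrite mulnS.
  by have := Gy 0; case y0 : (y 0); case y1 : (y 1) => // _ [|[|]].
have pre k : k <= j.+1 -> u = catseq (nseq k (u 0)) (shiftseq k u).
  move=> kj; have /pfxP : pfx (nseq k (u 0)) u.
    move=> i; rewrite size_nseq => ik; rewrite nth_nseq ik uj //; lia.
  by rewrite size_nseq.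
case: (pselect (G x)) => [/parseG[v xE]|].
  by exists j, v; rewrite -xE -pre.
(* A repetition at an even position forces all of them to even positions, so moving the grid by one
   letter makes every pair a block 01 or 10; the prefix becomes the whole run. *)
move=> /existsNP[i /negP]; rewrite negbK => /eqP xi.
have /parseG[v xE] : G (shiftseq j.+1 u).
  move=> k; apply/negP => /eqP; rewrite /shiftseq !addSn !addnS => e.
  have xk : x (2 * k).+1 = x (2 * k).+2 by rewrite /x /shiftseq !addnS.
  case: (ltngtP (2 * i) (2 * k).+1) => h; [|  |lia].
    by have := par _ _ h xi xk; lia.
  by have := par _ _ h xk xi; lia.
by exists j.+1, v; rewrite -xE -pre.
Qed.

Lemma desubst s P Q u : LMR s ->
  (forall x, P x -> (x <= act s hi0)%O) ->
  (forall x, Q x -> (act s lo1 <= x)%O) -> OmPQ P Q u ->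
  [\/ u = zeros, u = ones |
    exists c j v, u = catseq (nseq j c) (act s v) /\
      OmPQ (act s @^-1` P) (act s @^-1` Q) v].
Proof.
move=> sS PM QM uO; have sP := hp_LMR sS.
suff [->|->|[c [j [v uE]]]] : [\/ u = zeros, u = ones |
    exists c j v, u = catseq (nseq j c) (act s v)].
- exact: Or31.
- exact: Or32.
- apply: Or33; exists c, j, v; split=> //.
  by apply: (OmPQ_act (w := nseq j c)) => //; rewrite -uE.
move: sS PM QM => [[->|->]|->] PM QM; last 1 first.
- have [->|[j [v ->]]] := desubstR QM uO; first exact: Or31.
  by apply: Or33; exists false, j, v.
- have [->|[j [v ->]]] := desubstL PM uO; first exact: Or32.
  by apply: Or33; exists true, j, v.
- exact: desubstM PM QM uO.
Qed.

Lemma catseq_nseqE j c v n : catseq (nseq j c) v (j + n) = v n.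
Proof. by rewrite /catseq size_nseq ltnNge leq_addr /= addKn. Qed.

Lemma no01_shape (u : binseq) :
  (forall k, u k = false -> u k.+1 = true -> False) ->
  u = ones \/ exists j, u = catseq (nseq j true) zeros.
Proof.
move=> no01; have [u1|[j [uE uj]]] := first_change true u.
  by left; apply/funext => n; rewrite u1 onesE.
right; exists j; rewrite uE; congr catseq; apply/funext => n.
rewrite zerosE /shiftseq; elim: n => [|n IH]; first by rewrite addn0.
by rewrite addnS; apply/negbTE/negP => /no01; apply.
Qed.

Lemma shift_01 u k : u k = false -> u k.+1 = true ->
  shiftseq k u = catseq [:: false; true] (shiftseq k.+2 u).
Proof.
move=> uk uk1; rewrite -[k.+2]addn2 -shiftseqD; apply: (@pfxP [:: false; true]).
by move=> [|[|//]] _ /=; rewrite /shiftseq ?addn0 ?addn1.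
Qed.

Lemma list_hi0 w x : allin LMR w -> x 0 = false ->
  (act (comp_list w) x <= hi0)%O.
Proof. by move=> wS x0; apply: le_head0; rewrite act_head //; exact: hp_list. Qed.

Lemma list_lo1 w x : allin LMR w -> x 0 = true ->
  (lo1 <= act (comp_list w) x)%O.
Proof. by move=> wS x0; apply: ge_head1; rewrite act_head //; exact: hp_list. Qed.

(** * Trivial and countable cases by iterated desubstitution *)

(** After one occurrence of 01 the two bounds force the next two letters to be 01 again, so the tail
    would be (01)^oo, which the strict bound excludes. Only 1^j 0^oo and 1^oo survive. *)
Lemma trivial_base P Q u : (forall x, P x -> (x < act substM zeros)%O) ->
  (forall x, Q x -> (act substM lo1 <= x)%O) -> OmPQ P Q u ->
  u = zeros \/ u = ones.
Proof.
move=> PM QM uO; have no01 k : u k = false -> u k.+1 = true -> False.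
  move=> uk uk1; pose G := [set x | OmPQ P Q x /\ (x 0 = false /\ x 1 = true)].
  have Gx : G (shiftseq k u).
    by split; [exact: OmPQ_shift|rewrite /shiftseq addn0 addn1].
  suff GM n y : G y -> agree n y (act substM zeros).
    have := PM (shiftseq k u); rewrite (agreeP (fun n => GM n _ Gx)) ltxx.
    move=> h; apply: notF; apply: h.
    have := uO k; rewrite uk; by rewrite (agreeP (fun n => GM n _ Gx)).
  elim: n y => [//|n IH] y [yO [y0 y1]].
  have yE : y = catseq [:: false; true] (shiftseq 2 y) by exact: (shift_01 (k := 0)).
  have lt2 : (shiftseq 2 y < act substM zeros)%O.
    have := yO 0; rewrite y0 shiftseq0 => /PM.
    by rewrite {1}yE {1}actM_zeros_cons lt_catseqE.
  have y2 : y 2 = false.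
    apply/negbTE/negP => y2; have : (act substM zeros < shiftseq 2 y)%O.
      by apply: lt_head; rewrite ?actM_zerosE // /shiftseq addn0.
    by move=> /(lt_trans lt2); rewrite ltxx.
  have le3 : (act substM zeros <= shiftseq 3 y)%O.
    have := yO 1; rewrite y1 => /QM.
    have /pfxP -> : pfx [:: true; false] (shiftseq 1 y).
      by move=> [|[|//]] _; rewrite /shiftseq.
    by rewrite /lo1 (act_cons hp_M) le_catseq shiftseqD.
  have y3 : y 3 = true.
    apply/negPn/negP => /negbTE y3; have := yO 3; rewrite y3 => /PM.
    by rewrite ltNge le3.
  rewrite yE actM_zeros_cons.
  have : agree n (shiftseq 2 y) (act substM zeros).
    by apply: IH; split; [exact: OmPQ_shift|].
  move=> /(agree_catseq [:: false; true]); apply: agreeW; exact: leqW.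
have [|[[|j] uE]] := no01_shape no01; [by right|by left; rewrite uE catseq_nil|].
have shj : shiftseq j u = lo1.
  rewrite uE -addn1 nseqD catseq_cat; have := shift_catseq (nseq j true) lo1.
  by rewrite size_nseq.
have := uO j; rewrite shj; have -> : u j = true.
  by rewrite uE /catseq size_nseq leqnn nth_nseq leqnn.
(* The lower bound 10(01)^oo first exceeds 10^oo at index 3. *)
move=> /QM; rewrite leNgt => /negP[]; apply/seq_lexP; exists 3; split => //.
by move=> [|[|[|]]].
Qed.

(** By induction the desubstituted sequence is constant. What remains is to exclude the mixed
    sequences that its image and the leading run can form: each has a tail 10^oo, 01^oo, (01)^oo or
    (10)^oo that violates one of the bounds. *)
Lemma trivial_OmPQ w P Q u : allin LR w ->
  (forall x, P x -> (x < act (comp_list w) (act substM zeros))%O) ->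
  (forall x, Q x -> (act (comp_list w) (act substM lo1) <= x)%O) ->
  OmPQ P Q u -> u = zeros \/ u = ones.
Proof.
elim: w P Q u => [|s w IH] P Q u.
  by move=> _ PM QM; apply: trivial_base => x; [move=> /PM|move=> /QM]; rewrite act_id.
move=> /allin_cons[sS wS] PM QM uO.
have wP := hp_list (allin_LR wS); have sP := hp_LMR (LR_LMR sS).
have {}PM x : P x -> (x < act s (act (comp_list w) (act substM zeros)))%O.
  by move=> /PM; rewrite act_comp.
have {}QM x : Q x -> (act s (act (comp_list w) (act substM lo1)) <= x)%O.
  by move=> /QM; rewrite act_comp.
have AE : (act s (act (comp_list w) (act substM zeros)) <= act s hi0)%O.
  by rewrite act_leE //; apply: list_hi0 => //; exact: allin_LR.
have BE : (act s lo1 <= act s (act (comp_list w) (act substM lo1)))%O.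
  by rewrite act_leE //; apply: list_lo1 => //; exact: allin_LR.
(* As 10^oo < M(10^oo), the lower bound stays strictly above 10^oo after applying [w]. *)
have lo1N : (act (comp_list w) (act substM lo1) <= lo1)%O -> False.
  have : (lo1 < act substM lo1)%O by apply/seq_lexP; exists 3; split => // -[|[|[|]]].
  rewrite -(act_ltE wP) => h1 h2; have := lt_le_trans h1 h2.
  by rewrite ltNge list_lo1 //; exact: allin_LR.
have IHv j c v : u = catseq (nseq j c) (act s v) -> v = zeros \/ v = ones.
  move=> uE; apply: (IH (act s @^-1` P) (act s @^-1` Q)) => //.
  - by move=> x /PM; rewrite act_ltE.
  - by move=> x /QM; rewrite act_leE.
  - by apply: (OmPQ_act (w := nseq j c)) => //; rewrite -uE.
have tl j c v : u = catseq (nseq j.+1 c) v -> shiftseq j u = catseq [:: c] v.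
  move=> ->; rewrite -addn1 nseqD catseq_cat.
  by have := shift_catseq (nseq j c) (catseq [:: c] v); rewrite size_nseq.
have hd j c v : u = catseq (nseq j.+1 c) v -> u j = c.
  by move=> ->; rewrite /catseq size_nseq leqnn nth_nseq leqnn.
case: sS => sE; rewrite {}sE in PM QM AE BE IHv sP *.
  have [|[j [v uE]]] := desubstL (fun x h => ltW (lt_le_trans (PM x h) AE)) uO; first by right.
  case: (IHv _ _ _ uE) => vE; rewrite {}vE in uE.
    rewrite actL_zeros in uE; case: j => [|j] in uE; first by left; rewrite uE catseq_nil.
    have := uO j; rewrite (hd _ _ _ uE) (tl _ _ _ uE) => /QM.
    by rewrite -/lo1 -{2}actL_lo1 act_leE // => /lo1N.
  have uj : u j.+1 = false.
    by rewrite uE -addn1 catseq_nseqE actL_ones actM_ones1 catseq1E actM_zerosE.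
  have := uO j.+1; rewrite uj => /PM.
  have -> : shiftseq j.+1 u = act substM zeros.
    rewrite uE actL_ones actM_ones1 -catseq_cat.
    have := shift_catseq (nseq j true ++ [:: true]) (act substM zeros).
    by rewrite size_cat size_nseq addn1.
  by rewrite actL_hi0 in AE; rewrite ltNge AE.
have [|[j [v uE]]] := desubstR (fun x h => le_trans BE (QM x h)) uO; first by left.
case: (IHv _ _ _ uE) => vE; rewrite {}vE in uE.
  have uj : u j.+1 = true.
    by rewrite uE -addn1 catseq_nseqE actR_zeros actM_zerosE.
  have := uO j.+1; rewrite uj => /QM.
  have -> : shiftseq j.+1 u = act substM ones.
    rewrite uE actR_zeros actM_zeros1 -catseq_cat.
    have := shift_catseq (nseq j false ++ [:: false]) (act substM ones).
    by rewrite size_cat size_nseq addn1.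
  by rewrite -actR_lo1 act_leE // => /lo1N.
rewrite actR_ones in uE; case: j => [|j] in uE; first by right; rewrite uE catseq_nil.
have := uO j; rewrite (hd _ _ _ uE) (tl _ _ _ uE) => /PM.
by rewrite -/hi0 -{1}actR_hi0 ltNge AE.
Qed.

Lemma countable_catseq (A : set binseq) : countable A ->
  countable (\bigcup_(w in [set: seq bool]) (catseq w @` A)).
Proof.
move=> cA; apply: bigcup_countable; first exact: countableP.
by move=> w _; exact: sub_countable (card_image_le _ _) cA.
Qed.

Lemma countable_const : countable [set zeros; ones].
Proof. by apply: finite_set_countable; exact: finite_set2. Qed.

(** With no substitution left, the bound 010^oo makes every occurrence of 01 continue with 0^oo, so
    elements are eventually constant. Each desubstitution step only adds a finite word in front. *)
Lemma countable_OmPQ w P Q : allin LMR w ->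
  (forall x, P x -> (x <= act (comp_list w) (catseq [:: false; true] zeros))%O) ->
  (forall x, Q x -> (act (comp_list w) lo1 <= x)%O) ->
  countable (OmPQ P Q).
Proof.
elim: w P Q => [|s w IH] P Q.
  move=> _ PM _; apply: sub_countable (countable_catseq countable_const).
  apply: subset_card_le => u uO.
  case: (pselect (exists k, u k = false /\ u k.+1 = true)).
    move=> [k [uk uk1]]; exists (mkseq u k.+2) => //; exists zeros; first by left.
    rewrite [RHS](catseq_mkseq u k.+2); congr catseq.
    have := uO k; rewrite uk => /PM; rewrite act_id (shift_01 uk uk1) le_catseq => h.
    by apply/eqP; rewrite eq_le zeros_le h.
  move=> no01; have [||[j ->]] := @no01_shape u.
  - by move=> k uk uk1; apply: no01; exists k.
  - by move=> ->; exists [::] => //; exists ones; [right|rewrite catseq_nil].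
  - by exists (nseq j true) => //; exists zeros; [left|].
move=> /allin_cons[sS wS] PM QM.
have wP := hp_list wS; have sP := hp_LMR sS.
have cv := IH (act s @^-1` P) (act s @^-1` Q) wS.
have {}cv : countable (OmPQ (act s @^-1` P) (act s @^-1` Q)).
  apply: cv => x; [move=> /PM|move=> /QM];
  by rewrite act_comp // act_leE.
apply: (@sub_countable _ _ _ ([set zeros; ones] `|`
    \bigcup_(w in [set: seq bool]) (catseq w @` (act s @` OmPQ (act s @^-1` P) (act s @^-1` Q))))).
  apply: subset_card_le => u uO.
  have [||->|->|[c [j [v [-> vO]]]]] := desubst sS _ _ uO.
  - move=> x /PM /le_trans; apply; rewrite act_comp // act_leE //.
    exact: list_hi0.
  - move=> x /QM; apply: le_trans; rewrite act_comp // act_leE //.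
    exact: list_lo1.
  - by left; left.
  - by left; right.
  - by right; exists (nseq j c) => //; exists (act s v) => //; exists v.
rewrite -bigcup2E; apply: bigcup_countable => // -[|[|i]] _ //=; first exact: countable_const.
apply: countable_catseq; exact: sub_countable (card_image_le _ _) cv.
Qed.

(** * Sequences all of whose one-letter extensions are admissible *)

Definition ext_ok (a b x : binseq) :=
  (catseq [:: false] x <= a)%O /\ (b <= catseq [:: true] x)%O.

(* Unlike [Omega], these sets are preserved by substitutions. *)
Definition OmExt (a b : binseq) : set binseq :=
  [set u | forall k, ext_ok a b (shiftseq k u)].

Lemma shift_head (u : binseq) k : shiftseq k u = catseq [:: u k] (shiftseq k.+1 u).
Proof.
apply/funext => n; rewrite catseq1E /shiftseq; case: n => [|n].
  by rewrite addn0.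
by rewrite addnS addSn.
Qed.

Lemma OmExt_Omega a b u : OmExt a b u -> Omega a b u.
Proof.
move=> uE k; have [h0 h1] := uE k.+1.
by rewrite shift_head; case: (u k); [right|left].
Qed.

Lemma OmExt_top u : OmExt hi0 lo1 u.
Proof. by move=> k; split; rewrite le_catseq; [exact: le_ones|exact: zeros_le]. Qed.

Lemma OmExtW a b a' b' : (a <= a')%O -> (b' <= b)%O -> OmExt a b `<=` OmExt a' b'.
Proof.
by move=> aa bb u uE k; have [h1 h2] := uE k; split;
  [exact: le_trans h1 aa|exact: le_trans bb h2].
Qed.

Lemma ext_ok_flip a b x : ext_ok a b x -> ext_ok (flip b) (flip a) (flip x).
Proof.
by move=> [h1 h2]; split; [move: h2|move: h1]; rewrite -flip_le flip_catseq.
Qed.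

(** Prepending 0 delays the first 1 by one place. *)
Lemma le_cons0 x : (catseq [:: false] x <= x)%O.
Proof.
have [x0|[j [xE xj]]] := first_change false x.
  have -> : x = zeros by apply/funext => n; rewrite x0 zerosE.
  by rewrite -zeros_cons.
have y0 : shiftseq j x 0 = true by rewrite /shiftseq addn0 xj.
move: (shiftseq j x) y0 xE => y y0 -> {x xj}.
apply: ltW; apply/seq_lexP; exists j; rewrite catseq1E; split.
- move=> i ij; rewrite [RHS]/catseq size_nseq ij nth_nseq ij.
  by case: i ij => // i ij; rewrite /catseq size_nseq (ltnW ij) nth_nseq (ltnW ij).
- by case: j => // j; rewrite /catseq size_nseq leqnn nth_nseq leqnn.
- by have := catseq_nseqE j false y 0; rewrite addn0 => ->.
Qed.

(** These letters are what remains when an image is cut inside a block. They may also be put in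
    front of an image on purpose, which supplies the choices of the Cantor scheme. *)
Definition prependable (s : subst) c := exists d, s d = [:: d; c].

Lemma ext_okL a b x : b 0 = true -> ext_ok a b x ->
  ext_ok (act substL a) (act substL b) (act substL x) /\
  ext_ok (act substL a) (act substL b) (catseq [:: false] (act substL x)).
Proof.
move=> b0 [h0 h1].
have h0' : (catseq [:: false] (act substL x) <= act substL a)%O.
  by rewrite -(act_cons hp_L false) (act_leE hp_L).
have h1' : (act substL b <= catseq [:: true; false] (act substL x))%O.
  by rewrite -(act_cons hp_L true) (act_leE hp_L).
split; split => //.
- case: (boolP (x 0)) => x0.
    apply: (le_trans h1'); rewrite catseq_cons le_catseq; apply: ltW; apply: lt_head => //.
    by rewrite (act_head hp_L).
  apply: (le_trans h1'); rewrite catseq_cons le_catseq; exact: le_cons0.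
- by apply: (le_trans _ h0'); rewrite le_catseq; exact: le_cons0.
- by rewrite -catseq_cat.
Qed.

Lemma ext_okM a b x : a 0 = false -> b 0 = true -> ext_ok a b x ->
  ext_ok (act substM a) (act substM b) (act substM x) /\
  forall c, ext_ok (act substM a) (act substM b) (catseq [:: c] (act substM x)).
Proof.
move=> a0 b0 [h0 h1].
have h0' : (catseq [:: false; true] (act substM x) <= act substM a)%O.
  by rewrite -(act_cons hp_M false) (act_leE hp_M).
have h1' : (act substM b <= catseq [:: true; false] (act substM x))%O.
  by rewrite -(act_cons hp_M true) (act_leE hp_M).
have c0 y : (catseq [:: false; false] y <= act substM a)%O.
  by apply: le_trans h0'; rewrite (catseq_cons false [:: false]) (catseq_cons false [:: true]) le_catseq; apply: ltW; exact: lt_head.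
have c1 y : (act substM b <= catseq [:: true; true] y)%O.
  by apply: (le_trans h1'); rewrite (catseq_cons true [:: true]) (catseq_cons true [:: false]) le_catseq; apply: ltW; exact: lt_head.
split; last by case; split; rewrite -catseq_cat.
rewrite (act_unfold hp_M x); case x0 : (x 0); split; rewrite -catseq_cat //=.
- apply: le_trans h0'; rewrite (catseq_cat [:: false; true] [:: false]) (catseq_cat [:: false; true] [::]).
  rewrite le_catseq catseq_nil (act_unfold hp_M x) x0 ltW //; exact: lt_head.
- by rewrite (catseq_cat [:: true; true] [:: false]); exact: c1.
- by rewrite (catseq_cat [:: false; false] [:: true]); exact: c0.
- apply: (le_trans h1'); rewrite (catseq_cat [:: true; false] [:: true]) (catseq_cat [:: true; false] [::]).
  rewrite le_catseq catseq_nil (act_unfold hp_M x) x0 ltW //; exact: lt_head.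
Qed.

Lemma ext_ok_act s a b x : LMR s -> a 0 = false -> b 0 = true -> ext_ok a b x ->
  ext_ok (act s a) (act s b) (act s x) /\
  forall c, prependable s c -> ext_ok (act s a) (act s b) (catseq [:: c] (act s x)).
Proof.
move=> [[->|->]|->] a0 b0 h.
- have [h1 h2] := ext_okL b0 h; split => // c [[] //= [<-]] //.
- by have [h1 h2] := ext_okM a0 b0 h; split.
- have fb : flip a 0 = true by rewrite /flip a0.
  have [/ext_ok_flip h1 /ext_ok_flip h2] := ext_okL fb (ext_ok_flip h).
  rewrite flip_catseq /= in h2.
  rewrite -!(act_flip_subst _ hp_L) flip_substL !flipK in h1 h2.
  by split => // c [[] //= [<-]].
Qed.

Lemma LMR_drop s d i : LMR s -> i < size (s d) ->
  i = 0 \/ exists2 c, prependable s c & drop i (s d) = [:: c].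
Proof.
by move=> [[->|->]|->]; case: d i => [] [|[|//]] //= _; try (by left); right;
  eexists; [|reflexivity| |reflexivity| |reflexivity| |reflexivity];
  ((by exists true) || (by exists false)).
Qed.

(** A tail of the image starts at a block boundary or at the second letter of a two-letter block.
    The second case is why [ext_ok_act] also treats images with a prependable letter in front. *)
Lemma OmExt_act s a b u : LMR s -> a 0 = false -> b 0 = true -> OmExt a b u ->
  OmExt (act s a) (act s b) (act s u).
Proof.
move=> sS a0 b0 uE j; have sP := hp_LMR sS.
have [k [i [ik ->]]] := shift_act sP u j.
have [i0|[c cP ->]] := LMR_drop sS ik.
  rewrite i0 drop0 -(act_cons sP) -shift_head.
  by have [] := ext_ok_act sS a0 b0 (uE k).
by have [_] := ext_ok_act sS a0 b0 (uE k.+1); apply.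
Qed.

Lemma OmExt_cons s c a b u : LMR s -> prependable s c -> a 0 = false -> b 0 = true ->
  OmExt a b u -> OmExt (act s a) (act s b) (catseq [:: c] (act s u)).
Proof.
move=> sS cP a0 b0 uE [|j]; last first.
  by rewrite -add1n -shiftseqD (shift_catseq [:: c]); exact: OmExt_act.
by have [_ h] := ext_ok_act sS a0 b0 (uE 0); rewrite shiftseq0; exact: h.
Qed.

Lemma OmExt_list w a b u : allin LMR w -> a 0 = false -> b 0 = true -> OmExt a b u ->
  OmExt (act (comp_list w) a) (act (comp_list w) b) (act (comp_list w) u).
Proof.
move=> wS a0 b0 uE; elim: w wS => [|s w IH]; first by rewrite !act_id.
move=> /allin_cons[sS wS]; have wP := hp_list wS; have sP := hp_LMR sS.
rewrite /= !act_comp //; apply: OmExt_act => //; first by rewrite act_head.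
  by rewrite act_head.
exact: IH.
Qed.

Lemma OmExt_alternating : OmExt (act substM zeros) (act substM ones) (act substM zeros).
Proof.
have le01 : (act substM zeros <= act substM ones)%O.
  by rewrite act_leE ?zeros_le //; exact: hp_M.
have le1 : (act substM ones <= catseq [:: true] (act substM ones))%O.
  by rewrite {1}actM_ones1 le_catseq.
have le0 : (catseq [:: false] (act substM zeros) <= act substM zeros)%O.
  by rewrite {2}actM_zeros1 le_catseq.
move=> j; have [k [i [ik ->]]] := shift_act hp_M zeros j.
have -> : shiftseq k.+1 zeros = zeros by apply/funext => n; rewrite /shiftseq !zerosE.
rewrite zerosE in ik *; case: i ik => [|[|//]] _.
  rewrite drop0 -actM_zeros_cons; split; [exact: le0|by rewrite -actM_ones1].
by rewrite /= -actM_ones1; split; [by rewrite -actM_zeros1|exact: le1].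
Qed.

Lemma OmExt_nontrivial w a b : allin LMR w ->
  (act (comp_list w) (act substM zeros) <= a)%O ->
  (b <= act (comp_list w) (act substM ones))%O ->
  Omega a b <> [set zeros; ones].
Proof.
move=> wS aE bE OE; have wP := hp_list wS.
have : Omega a b (act (comp_list w) (act substM zeros)).
  apply: OmExt_Omega; apply: (OmExtW aE bE); apply: OmExt_list => //.
  exact: OmExt_alternating.
rewrite OE => -[e|/(congr1 (fun u : binseq => u 0))]; last first.
  by rewrite !act_head ?zerosE ?onesE //; exact: hp_M.
have : (act (comp_list w) zeros < zeros)%O.
  by rewrite -[X in (_ < X)%O]e act_ltE //; apply/seq_lexP; exists 1; split => // -[].
by rewrite ltNge zeros_le.
Qed.

(** * Uncountability *)

(** Diagonal argument against an injection [g] into the integers. At stage n at most one point has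
    code n, and it cannot begin with both branches, so one branch avoids it. The limit point then
    has no possible code. *)
Lemma cantor_scheme (G : set (seq bool)) (X : set binseq) : G !=set0 ->
  (forall w, G w -> exists v1 v2 i, [/\ G (w ++ v1), G (w ++ v2),
     i < size v1, i < size v2 & nth false v1 i != nth false v2 i]) ->
  (forall u, (forall N, exists w, [/\ G w, N <= size w & pfx w u]) -> X u) ->
  ~ countable X.
Proof.
move=> [w0 Gw0] branch closedX /countable_injP[g ginj].
have step n w : exists v, G w -> [/\ G (w ++ v), 0 < size v &
    forall x, X x -> g x = n -> ~ pfx (w ++ v) x].
  case: (pselect (G w)) => [Gw|]; last by move=> nG; exists [::].
  have [v1 [v2 [i [G1 G2 i1 i2 ne]]]] := branch _ Gw.
  case: (pselect (exists x, [/\ X x, g x = n & pfx (w ++ v1) x])).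
    move=> [x [Xx gx px]]; exists v2; split => //; first exact: leq_ltn_trans i2.
    move=> y Xy gy py; have xy : x = y.
      by apply: ginj; rewrite ?inE // gx gy.
    move: ne; apply/negP; rewrite negbK; apply/eqP.
    have := px (size w + i); rewrite size_cat ltn_add2l => /(_ i1).
    have := py (size w + i); rewrite size_cat ltn_add2l => /(_ i2).
    by rewrite !nth_cat !ltnNge !leq_addr /= !addKn xy => -> ->.
  move=> H; exists v1; split => //; first exact: leq_ltn_trans i1.
  by move=> x Xx gx px; apply: H; exists x.
have [f fP] := choice (fun p : nat * seq bool => step p.1 p.2).
pose W := fix W n := if n is n'.+1 then W n' ++ f (n', W n') else w0.
have GW n : G (W n) by elim: n => //= n IH; have [] := fP (n, W n) IH.
have szW n : n <= size (W n).
  elim: n => //= n IH; have [_ /= h _] := fP (n, W n) (GW n).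
  by rewrite size_cat; move: h IH; lia.
pose u : binseq := fun i => nth false (W i.+1) i.
have WD m k : exists v, W (m + k) = W m ++ v.
  elim: k => [|k [v vE]]; first by exists [::]; rewrite addn0 cats0.
  by rewrite addnS /= vE; eexists; rewrite -catA.
have pW n : pfx (W n) u.
  move=> i iW; rewrite /u; case: (leqP n i.+1) => [/subnKC|/ltnW/subnKC] <-.
    by have [v ->] := WD n (i.+1 - n); rewrite nth_cat iW.
  by have [v ->] := WD i.+1 (n - i.+1); rewrite nth_cat szW.
have Xu : X u by apply: closedX => N; exists (W N).
by have [_ _ /(_ u Xu erefl)] := fP (g u, W (g u)) (GW _); apply; exact: (pW (g u).+1).
Qed.

Lemma uncountable_image s (X : set binseq) : head_preserving s ->
  (forall u, X (act s u)) -> ~ countable X.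
Proof.
move=> sP sX cX.
have : ~ countable [set: binseq].
  apply: (@cantor_scheme [set: seq bool]) => //; first by exists [::].
  by move=> w _; exists [:: false], [:: true], 0.
apply; have [g ginj] := countable_injP X cX; apply/countable_injP.
exists (fun u => g (act s u)) => u v _ _ e; apply: (act_inj sP).
by apply: ginj; rewrite ?inE.
Qed.

(** * Iterated substitutions *)

Lemma act_list_cat w1 w2 u : allin LMR w1 -> allin LMR w2 ->
  act (comp_list (w1 ++ w2)) u = act (comp_list w1) (act (comp_list w2) u).
Proof. by move=> /hp_list h1 /hp_list h2; rewrite comp_list_catE act_comp. Qed.

Lemma allin_nseq S s n : S s -> allin S (nseq n s).
Proof. by move=> Ss t /nseqP[->]. Qed.

Lemma allin_cat S w1 w2 : allin S w1 -> allin S w2 -> allin S (w1 ++ w2).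
Proof. by move=> h1 h2 s; rewrite mem_cat => /orP[/h1|/h2]. Qed.

Lemma allin_nseqR n : allin LMR (nseq n substR).
Proof. by apply: allin_nseq; right. Qed.

Lemma allin_nseqL n : allin LMR (nseq n substL).
Proof. by apply: allin_nseq; left; left. Qed.

(** Each application of [R] inserts one more 1 after the leading 0 and keeps the 1s already
    there. *)
Lemma actR_iter n x : x 0 = false ->
  agree n.+1 (act (comp_list (nseq n substR)) x) hi0.
Proof.
move=> x0; have nP k : head_preserving (comp_list (nseq k substR)).
  exact: hp_list (@allin_nseqR _).
elim: n => [|n IH]; first by rewrite act_id => -[|//] _; rewrite x0.
rewrite /= act_comp //; last exact: hp_R.
set y := act _ x in IH *; have y0 : y 0 = false by rewrite IH.
have zE : agree n (shiftseq 1 y) ones.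
  by move=> i iN; rewrite /shiftseq IH ?ltnS // add1n /hi0 catseqS catseq_nil.
rewrite (act_unfold hp_R) y0 /= /hi0 ones_cons -catseq_cat.
apply: (agree_catseq [:: false; true]); rewrite -actR_ones; exact: act_agree.
Qed.

Arguments actR_iter n {x} _.

Lemma actR_iter_cons n x : act (comp_list (nseq n substR)) (catseq [:: true] x) =
  catseq [:: true] (act (comp_list (nseq n substR)) x).
Proof.
elim: n => [|n IH]; first by rewrite !act_id.
have nP k : head_preserving (comp_list (nseq k substR)).
  exact: hp_list (@allin_nseqR _).
by rewrite /= !act_comp ?IH ?(act_cons hp_R) //; exact: hp_R.
Qed.

Lemma actR_iter_hi0 n : act (comp_list (nseq n substR)) hi0 = hi0.
Proof.
elim: n => [|n IH]; first by rewrite act_id.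
rewrite /= act_comp ?IH ?actR_hi0 //; first exact: hp_R.
exact: hp_list (@allin_nseqR _).
Qed.

Lemma actL_iter_flip n x : act (comp_list (nseq n substL)) x =
  flip (act (comp_list (nseq n substR)) (flip x)).
Proof.
rewrite -act_flip_list ?flipK; last exact: allin_nseqR.
by rewrite map_nseq flip_substR.
Qed.

Lemma actL_iter n x : x 0 = true ->
  agree n.+1 (act (comp_list (nseq n substL)) x) lo1.
Proof.
move=> x0 i iN; rewrite actL_iter_flip -flip_hi0 /flip.
by rewrite (actR_iter n) // /flip x0.
Qed.

Arguments actL_iter n {x} _.

Lemma actL_iter_cons n x : act (comp_list (nseq n substL)) (catseq [:: false] x) =
  catseq [:: false] (act (comp_list (nseq n substL)) x).
Proof. by rewrite !actL_iter_flip flip_catseq /= actR_iter_cons flip_catseq. Qed.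

(* [M (10^oo) = L (101^oo)], and [L R^n] maps [01^oo] to [M (0^oo)] while
   [L R^n (10^oo)] converges to [M (10^oo)]. *)
Lemma full_image_of_lt w (a b : binseq) : allin LMR w ->
  (act (comp_list w) (act substM zeros) <= a)%O ->
  (b < act (comp_list w) (act substM lo1))%O ->
  exists2 v, allin LMR v & (act (comp_list v) hi0 <= a)%O /\ (b <= act (comp_list v) lo1)%O.
Proof.
move=> wS aE bE; have [m [bw bm wm]] := (seq_lexP _ _).1 bE.
have LS : allin LMR (substL :: nseq m substR).
  by apply/allin_cons; split; [left; left|exact: allin_nseqR].
have RP : head_preserving (comp_list (nseq m substR)).
  exact: hp_list (@allin_nseqR _).
(* At index [m] the sequence [b] drops below the target; with [m] copies of [R] the approximation
   agrees with the target through that index. *)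
exists (w ++ substL :: nseq m substR); first exact: allin_cat.
rewrite !act_list_cat // /= !act_comp //; try exact: hp_L.
rewrite actR_iter_hi0 actL_hi0; split=> //.
rewrite actM_lo1 in bw wm; apply: ltW; apply/seq_lexP; exists m.
have ag : agree m.+1 (act (comp_list w) (act substL (act (comp_list (nseq m substR)) lo1)))
    (act (comp_list w) (act substL (catseq [:: true; false] ones))).
  apply: act_agree; apply: act_agree; rewrite /lo1 actR_iter_cons (catseq_cons true [:: false]).
  by apply: (agreeW _ (agree_catseq [:: true] (actR_iter m (erefl : zeros 0 = false)))).
split => //; last by rewrite ag.
by move=> i im; rewrite bw // ag //; exact: ltnW.
Qed.

Lemma full_image_of_gt w (a b : binseq) : allin LMR w ->
  (act (comp_list w) (act substM hi0) < a)%O ->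
  (b <= act (comp_list w) (act substM ones))%O ->
  exists2 v, allin LMR v & (act (comp_list v) hi0 <= a)%O /\ (b <= act (comp_list v) lo1)%O.
Proof.
move=> wS aE bE.
have [||| v vS [v1 v2]] := @full_image_of_lt (map flip_subst w) (flip b) (flip a).
- exact: allin_flip LMR_flip wS.
- rewrite -flip_ones -flip_substM act_flip_subst; last exact: hp_M.
  by rewrite act_flip_list // flip_le.
- rewrite -flip_hi0 -flip_substM act_flip_subst; last exact: hp_M.
  by rewrite act_flip_list // flip_lt.
exists (map flip_subst v); first exact: allin_flip LMR_flip vS.
by rewrite -flip_lo1 -{2}flip_hi0 !act_flip_list //; split; rewrite -flip_le flipK.
Qed.

Lemma full_image_Omega v (a b u : binseq) : allin LMR v ->
  (act (comp_list v) hi0 <= a)%O -> (b <= act (comp_list v) lo1)%O ->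
  Omega a b (act (comp_list v) u).
Proof.
move=> vS aE bE; apply: OmExt_Omega; apply: (OmExtW aE bE); apply: OmExt_list => //.
exact: OmExt_top.
Qed.

(** * Limits of substitutions *)

Lemma cantor_cvg (f : nat -> cantor_space) (x : cantor_space) :
  (forall i, \forall n \near \oo, f n i = x i) -> f @ \oo --> x.
Proof.
move=> H; have := (@pointwise_cvgP nat bool (f @ \oo) x _).2.
by apply => i; apply/discrete_cvg; exact: H.
Qed.

Section Directive.
Variable s : nat -> subst.
Hypothesis sS : range s `<=` LMR.

Let sS' n : LMR (s n).
Proof. by apply: sS; exists n. Qed.

Lemma allin_mkseq n : allin LMR (mkseq s n).
Proof. by move=> t /mapP[i _ ->]. Qed.

Lemma hp_mkseq n : head_preserving (comp_list (mkseq s n)).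
Proof. by apply: hp_list; exact: allin_mkseq. Qed.

Lemma mkseqD n k : mkseq s (n + k) = mkseq s n ++ mkseq (fun i => s (n + i)) k.
Proof.
rewrite /mkseq iotaD map_cat add0n; congr cat.
by rewrite -{1}[n]addn0 iotaDl -map_comp.
Qed.

Lemma allin_mkseqD n k : allin LMR (mkseq (fun i => s (n + i)) k).
Proof. by move=> t /mapP[i _ ->]. Qed.

Lemma comp_mkseqS n c :
  comp_list (mkseq s n.+1) c = act_word (comp_list (mkseq s n)) (s n c).
Proof. by rewrite mkseqS comp_list_rcons. Qed.

Lemma act_mkseqS n u :
  act (comp_list (mkseq s n.+1)) u = act (comp_list (mkseq s n)) (act (s n) u).
Proof. by rewrite mkseqS act_rcons //; exact: allin_mkseq. Qed.

Lemma act_mkseqD n k u : exists2 v, v 0 = u 0 &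
  act (comp_list (mkseq s (n + k))) u = act (comp_list (mkseq s n)) v.
Proof.
exists (act (comp_list (mkseq (fun i => s (n + i)) k)) u).
  by rewrite act_head //; apply: hp_list; exact: allin_mkseqD.
by rewrite mkseqD act_list_cat //; [exact: allin_mkseq|exact: allin_mkseqD].
Qed.

Lemma pfx_mkseq_act n u : pfx (comp_list (mkseq s n) (u 0)) (act (comp_list (mkseq s n)) u).
Proof. by rewrite (act_unfold (hp_mkseq n)); exact: pfx_catseq. Qed.

Lemma pfx_mkseqD n m u : n <= m ->
  pfx (comp_list (mkseq s n) (u 0)) (act (comp_list (mkseq s m)) u).
Proof.
move=> /subnKC <-; have [v <- ->] := act_mkseqD n (m - n) u.
exact: pfx_mkseq_act.
Qed.

Lemma size_mkseqS n c : size (comp_list (mkseq s n) c) <= size (comp_list (mkseq s n.+1) c).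
Proof.
rewrite comp_mkseqS; have [w ->] := hp_LMR (sS' n) c.
by rewrite act_word_cons size_cat leq_addr.
Qed.

Lemma size_mkseq_le n m c : n <= m ->
  size (comp_list (mkseq s n) c) <= size (comp_list (mkseq s m) c).
Proof.
move=> /subnKC <-; elim: (m - n) => [|k IH]; first by rewrite addn0.
by rewrite addnS; apply: leq_trans IH _; exact: size_mkseqS.
Qed.

Definition unbounded c := forall N, exists n, N <= size (comp_list (mkseq s n) c).

(** The words s_1...s_n(c) are nested, so once their lengths are unbounded only the first letter of
    [u] matters. Having them as prefixes for cofinally many n is enough, which is all that the
    exhaustion over [L] and [R] provides. *)
Lemma act_lim_unique c a u : unbounded c -> u 0 = c ->
  (forall N, exists n, N <= n /\ pfx (comp_list (mkseq s n) c) a) -> a = act_lim s u.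
Proof.
move=> cU u0 ca; apply/esym; apply: (@cvg_lim cantor_space).
  exact: cantor_space_hausdorff.
apply: cantor_cvg => i; have [n1 n1i] := cU i.+1; have [n2 [n12 pa]] := ca n1.
exists n2 => // n /= n2n.
have iN : i < size (comp_list (mkseq s n2) c) by apply: leq_trans n1i (size_mkseq_le c n12).
by apply: (pfx_agree _ pa) iN; rewrite -u0; exact: pfx_mkseqD.
Qed.

(** The limit is built letter by letter from any word of the nested family long enough to reach
    index i; the choice does not matter because two such words are prefixes of a common sequence. *)
Lemma act_lim_pfx c u : unbounded c -> u 0 = c ->
  forall n, pfx (comp_list (mkseq s n) c) (act_lim s u).
Proof.
move=> cU u0; pose a : binseq := fun i =>
  let n := sval (cid (cU i.+1)) in nth false (comp_list (mkseq s n) c) i.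
have ca n : pfx (comp_list (mkseq s n) c) a.
  move=> i iN; rewrite /a; case: (cid _) => m /= mi.
  have [p1 p2] : pfx (comp_list (mkseq s n) c) (act (comp_list (mkseq s (n + m))) u) /\
      pfx (comp_list (mkseq s m) c) (act (comp_list (mkseq s (n + m))) u).
    by rewrite -u0; split; apply: pfx_mkseqD; rewrite ?leq_addr ?leq_addl.
  by rewrite -p1 // -p2.
by have <- : a = act_lim s u by apply: (act_lim_unique (c := c)) => // N; exists N.
Qed.

Hypothesis sprim : primitive s.

Lemma not_ends t : t = substL \/ t = substR -> forall n, exists2 m, n <= m & s m <> t.
Proof.
move=> tE n; apply: contrapT => H.
suff : ends_with s t by have [h1 h2] := sprim; case: tE => ->.
exists n => m nm; apply: contrapT => smt; apply: H; by exists m.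
Qed.

(** The word of 1 gets longer at every step other than [R], that of 0 at every step other than [L],
    and both kinds of step recur. *)
Lemma primitive_unbounded N :
  exists n, forall c, N <= size (comp_list (mkseq s n) c).
Proof.
elim: N => [|N [n nN]]; first by exists 0.
have szS m c : s m c <> [:: c] -> N <= size (comp_list (mkseq s m) c) ->
    (forall d, 0 < size (comp_list (mkseq s m) d)) ->
    N.+1 <= size (comp_list (mkseq s m.+1) c).
  rewrite comp_mkseqS; have [w ->] := hp_LMR (sS' m) c.
  case: w => // d w _ h1 h2; rewrite !act_word_cons !size_cat.
  by have := h2 d; move: h1; clear; lia.
have pos m d := hp_size (hp_mkseq m) d.
have [m1 nm1 s1] := not_ends (or_introl erefl) n.
have [m2 nm2 s2] := not_ends (or_intror erefl) n.
exists (maxn m1 m2).+1; case.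
  have h : N.+1 <= size (comp_list (mkseq s m2.+1) true).
    apply: szS => //; last exact: leq_trans (nN _) (size_mkseq_le _ nm2).
    by move: (sS' m2) s2 => [[->|->]|->].
  by apply: leq_trans h (size_mkseq_le _ _); rewrite ltnS leq_maxr.
have h : N.+1 <= size (comp_list (mkseq s m1.+1) false).
  apply: szS => //; last exact: leq_trans (nN _) (size_mkseq_le _ nm1).
  by move: (sS' m1) s1 => [[->|->]|->].
by apply: leq_trans h (size_mkseq_le _ _); rewrite ltnS leq_maxl.
Qed.

Lemma primitive_size N : exists n, forall m c, n <= m -> N <= size (comp_list (mkseq s m) c).
Proof.
have [n nN] := primitive_unbounded N; exists n => m c nm.
exact: leq_trans (nN c) (size_mkseq_le c nm).
Qed.

Lemma unboundedT c : unbounded c.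
Proof. by move=> N; have [n nN] := primitive_unbounded N; exists n. Qed.

Section Bounds.
Variables a b : binseq.
Hypothesis aE : a = act_lim s zeros.
Hypothesis bE : b = act_lim s ones.

Let apfx n : pfx (comp_list (mkseq s n) false) a.
Proof. by rewrite aE; apply: act_lim_pfx; [exact: unboundedT|exact: zerosE]. Qed.

Let bpfx n : pfx (comp_list (mkseq s n) true) b.
Proof. by rewrite bE; apply: act_lim_pfx; [exact: unboundedT|exact: onesE]. Qed.

Lemma act_lim_le n : (a <= act (comp_list (mkseq s n)) hi0)%O.
Proof.
apply: le_of_agree => N; have [n0 n0N] := primitive_size N.
exists (act (comp_list (mkseq s (n + n0))) zeros), (act (comp_list (mkseq s n)) hi0).
split => //.
  apply: (agreeW (n0N _ false (leq_addl n n0))); apply: (pfx_agree _ (@apfx _)).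
  exact: pfx_mkseq_act.
have [v v0 ->] := act_mkseqD n n0 zeros; rewrite act_leE; last exact: hp_mkseq.
by apply: le_head0; rewrite v0.
Qed.

Lemma act_lim_ge n : (act (comp_list (mkseq s n)) lo1 <= b)%O.
Proof.
apply: le_of_agree => N; have [n0 n0N] := primitive_size N.
exists (act (comp_list (mkseq s n)) lo1), (act (comp_list (mkseq s (n + n0))) ones).
split => //.
  apply: (agreeW (n0N _ true (leq_addl n n0))); apply: (pfx_agree _ (@bpfx _)).
  exact: pfx_mkseq_act.
have [v v0 ->] := act_mkseqD n n0 ones; rewrite act_leE; last exact: hp_mkseq.
by apply: ge_head1; rewrite v0.
Qed.

(* [w] is the already constructed beginning of a sequence that continues with the image
   under the first [n] substitutions of a sequence to be chosen. *)
Definition reach n w := forall x y u, x 0 = false -> y 0 = true -> OmExt x y u ->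
  OmExt (act (comp_list (mkseq s n)) x) (act (comp_list (mkseq s n)) y)
    (catseq w (act (comp_list (mkseq s n)) u)).

Lemma reachS n w : reach n w -> reach n.+1 w.
Proof.
move=> wP x y u x0 y0 uO; rewrite !act_mkseqS; have sP := hp_LMR (sS' n).
by apply: wP; rewrite ?act_head //; exact: OmExt_act.
Qed.

Lemma reach_le n m w : n <= m -> reach n w -> reach m w.
Proof.
move=> /subnKC <- wP; elim: (m - n) => [|k IH]; first by rewrite addn0.
by rewrite addnS; exact: reachS.
Qed.

Lemma reach_cons n w c : prependable (s n) c -> reach n w ->
  reach n.+1 (w ++ comp_list (mkseq s n) c).
Proof.
move=> cP wP x y u x0 y0 uO; have sP := hp_LMR (sS' n).
rewrite !act_mkseqS catseq_cat -(act_cons (hp_mkseq n)).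
by apply: wP; rewrite ?act_head //; exact: OmExt_cons.
Qed.

(** At a later step other than [R] the letter 0 can be prepended, and at a later step other than [L]
    the letter 1. The two inserted words start with different letters, so index 0 separates the
    branches. *)
Lemma uncountable_lim : ~ countable (Omega a b).
Proof.
apply: (@cantor_scheme [set w | exists n, reach n w]).
- exists [::], 0 => x y u x0 y0 uO; rewrite catseq_nil.
  exact: (OmExt_list (w := [::])).
- move=> w [n wP].
  have [m1 nm1 s1] := not_ends (or_introl erefl) n.
  have [m2 nm2 s2] := not_ends (or_intror erefl) n.
  exists (comp_list (mkseq s m2) false), (comp_list (mkseq s m1) true), 0.
  split; try exact: hp_size (hp_mkseq _) _.
  + exists m2.+1; apply: reach_cons (reach_le nm2 wP).
    by move: (sS' m2) s2 => [[->|->]|->] // _; [exists true|exists true].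
  + exists m1.+1; apply: reach_cons (reach_le nm1 wP).
    by move: (sS' m1) s1 => [[->|->]|->] // _; [exists false|exists false].
  + by have [v ->] := hp_mkseq m2 false; have [v' ->] := hp_mkseq m1 true.
move=> u uP; apply: OmExt_Omega => k.
(* The limit point is approximated by members of [OmExt] whose bounds agree with [a] and [b] on N
   letters; k+N letters of agreement are requested since the first k are shifted away. *)
have ext N : exists m v, [/\ forall c, N <= size (comp_list (mkseq s m) c),
    agree N (shiftseq k v) (shiftseq k u) &
    OmExt (act (comp_list (mkseq s m)) hi0) (act (comp_list (mkseq s m)) lo1) v].
  have [w [[n wP] wN wu]] := uP (k + N); have [n0 n0N] := primitive_size N.
  exists (n + n0), (catseq w (act (comp_list (mkseq s (n + n0))) zeros)); split.
  - by move=> c; apply: n0N; exact: leq_addl.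
  - move=> i iN; have := pfx_agree (pfx_catseq w (act (comp_list (mkseq s (n + n0))) zeros)) wu.
    by apply; apply: leq_trans wN; rewrite ltn_add2l.
  - have := reach_le (leq_addr n0 n) wP; apply => //; exact: OmExt_top.
split; apply: le_of_agree => N; have [m [v [mN vu /(_ k)[v0 v1]]]] := ext N.
  exists (catseq [:: false] (shiftseq k v)), (act (comp_list (mkseq s m)) hi0); split => //.
    by apply: agreeW (agree_catseq [:: false] vu); exact: leq_addl.
  by apply: (agreeW (mN false)); apply: (pfx_agree _ (@apfx m)); exact: pfx_mkseq_act.
exists (act (comp_list (mkseq s m)) lo1), (catseq [:: true] (shiftseq k v)); split => //.
  by apply: (agreeW (mN true)); apply: (pfx_agree _ (@bpfx m)); exact: pfx_mkseq_act.
by apply: agreeW (agree_catseq [:: true] vu); exact: leq_addl.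
Qed.

End Bounds.
End Directive.

(** * Exhaustion *)

Lemma directive_sequence (I : set (seq subst)) (J : seq subst -> subst -> Prop) :
  I [::] -> (forall w, I w -> exists s, I (rcons w s) /\ J w s) ->
  exists s : nat -> subst, forall n, I (mkseq s n) /\ J (mkseq s n) (s n).
Proof.
move=> I0 step.
have step' w : exists s, I w -> I (rcons w s) /\ J w s.
  by case: (pselect (I w)) => [/step[s sP]|nI]; [exists s|exists substL].
have [f fP] := choice step'.
pose W := fix W n := if n is n'.+1 then rcons (W n') (f (W n')) else [::].
have IW n : I (W n) by elim: n => //= n /fP[].
exists (fun n => f (W n)) => n.
have -> : mkseq (fun n => f (W n)) n = W n.
  by elim: n => //= n IH; rewrite mkseqS IH.
by split; [|have [] := fP _ (IW n)].
Qed.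

(** Cylinders are intervals of the lexicographic order. *)
Lemma sandwich v (x y a : binseq) : pfx v x -> pfx v y -> (x <= a)%O -> (a <= y)%O ->
  pfx v a.
Proof.
move=> vx vy xa ay; apply: contrapT => H.
have h : ~ agree (size v) a x by move=> /agree_sym ax; apply: H => i iv; rewrite -ax // vx.
have xy := pfx_agree vx vy.
have xa' : (x < a)%O.
  rewrite lt_neqAle xa andbT; apply/eqP => e; apply: h; by rewrite e.
have : (y < a)%O.
  apply: (lt_agree (u := x) (v := a) (N := size v)) => //.
  by move=> /agree_sym.
by rewrite ltNge ay.
Qed.

Lemma act_list_pfx w c (x : binseq) : allin LMR w -> x 0 = c ->
  pfx (comp_list w c) (act (comp_list w) x).
Proof.
by move=> wS <-; rewrite (act_unfold (hp_list wS)); exact: pfx_catseq.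
Qed.
Arguments act_list_pfx {w c x} _ _.

Lemma mkseq_ends_with (s : nat -> subst) t N k : (forall n, N <= n -> s n = t) ->
  mkseq s (N + k) = mkseq s N ++ nseq k t.
Proof.
move=> st; rewrite /mkseq iotaD map_cat add0n; congr cat.
apply: (@eq_from_nth _ t); rewrite size_map size_iota ?size_nseq // => i ik.
rewrite (nth_map 0) ?size_iota // nth_iota // nth_nseq ik.
by apply: st; exact: leq_addr.
Qed.

Lemma not_or3 (P Q R : Prop) : ~ [\/ P, Q | R] -> [/\ ~ P, ~ Q & ~ R].
Proof. by move=> H; split=> h; apply: H; [apply: Or31|apply: Or32|apply: Or33]. Qed.

Lemma not_or4 (P Q R S : Prop) : ~ [\/ P, Q, R | S] -> [/\ ~ P, ~ Q, ~ R & ~ S].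
Proof.
by move=> H; split=> h; apply: H; [apply: Or41|apply: Or42|apply: Or43|apply: Or44].
Qed.

Definition a010 : binseq := catseq [:: false; true] zeros.
Definition b101 : binseq := catseq [:: true; false] ones.

(** The weak inequalities of the invariant [I] allow the next step; its strict ones come from the
    failure of the countable alternative and serve to prove primitivity. *)
Lemma exhaust_LMR (a b : binseq) : a 0 = false -> b 0 = true ->
  [\/ exists2 w, allin LMR w &
       (act (comp_list w) (act substM zeros) <= a /\
        b < act (comp_list w) (act substM lo1))%O \/
       (act (comp_list w) (act substM hi0) < a /\
        b <= act (comp_list w) (act substM ones))%O,
      exists s : nat -> subst, [/\ range s `<=` LMR, primitive s,
        a = act_lim s zeros & b = act_lim s ones] |
      exists2 w, allin LMR w &
       (a <= act (comp_list w) a010 /\ act (comp_list w) lo1 <= b)%O \/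
       (a <= act (comp_list w) hi0 /\ act (comp_list w) b101 <= b)%O].
Proof.
move=> a0 b0; apply: contrapT => /not_or3[n3 n4 n5].
pose I := [set w | [/\ allin LMR w,
  (act (comp_list w) a010 < a /\ a <= act (comp_list w) hi0)%O &
  (act (comp_list w) lo1 <= b /\ b < act (comp_list w) b101)%O]].
have I0 w : allin LMR w -> (a <= act (comp_list w) hi0)%O ->
    (act (comp_list w) lo1 <= b)%O -> I w.
  move=> wS ha hb; split => //; split => //; rewrite ltNge; apply/negP => h.
    by apply: n5; exists w => //; left.
  by apply: n5; exists w => //; right.
have [|w [wS [a1 a2] [b1 b2]]|s sP] := @directive_sequence I (fun _ s => LMR s).
- by apply: I0; rewrite // act_id; [exact: le_head0|exact: ge_head1].
- case: (leP a (act (comp_list w) (act substM zeros))) => ha.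
    exists substL; split; last by left; left.
    apply: I0; first by apply: allin_rcons => //; left; left.
      by rewrite act_rcons ?actL_hi0 //; left; left.
    by rewrite act_rcons ?actL_lo1 //; left; left.
  case: (leP (act (comp_list w) (act substM ones)) b) => hb.
    exists substR; split; last by right.
    apply: I0; first by apply: allin_rcons => //; right.
      by rewrite act_rcons ?actR_hi0 //; right.
    by rewrite act_rcons ?actR_lo1 //; right.
  (* Neither [L] nor [R] was permitted, so the failure of the positive entropy alternative yields
     exactly the two bounds that [M] needs. *)
  exists substM; split; last by left; right.
  apply: I0; first by apply: allin_rcons => //; left; right.
    rewrite act_rcons //; last by left; right.
    rewrite leNgt; apply/negP => h; apply: n3; exists w => //; right.
    by split => //; exact: ltW.
  rewrite act_rcons //; last by left; right.
  rewrite leNgt; apply/negP => h; apply: n3; exists w => //; left.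
  by split => //; exact: ltW.
have sS : range s `<=` LMR by move=> _ [n _ <-]; have [] := sP n.
have IP n := (sP n).1.
apply: n4; exists s.
(* With a tail of [L] the upper bounds w L^k(01^oo) tend to w(010^oo), contrary to the strict
   inequality of [I]; a tail of [R] is symmetric with 101^oo. *)
have prim : primitive s.
  split=> -[N sN].
    have [wS [a1 _] _] := IP N.
    have : (a <= act (comp_list (mkseq s N)) a010)%O.
      apply: le_of_agree => k; have [_ [_ a2] _] := IP (N + k).
      exists a, (act (comp_list (mkseq s (N + k))) hi0); split => //.
      rewrite (mkseq_ends_with _ sN) act_list_cat //; last exact: allin_nseqL.
      apply: act_agree; rewrite /hi0 actL_iter_cons /a010 (catseq_cons false [:: true]).
      by apply: (agreeW _ (agree_catseq [:: false] (actL_iter k (onesE 0)))); rewrite addnS ltnW.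
    by rewrite leNgt a1.
  have [wS _ [_ b1]] := IP N.
  have : (act (comp_list (mkseq s N)) b101 <= b)%O.
    apply: le_of_agree => k; have [_ _ [b2 _]] := IP (N + k).
    exists (act (comp_list (mkseq s (N + k))) lo1), b; split => //.
    rewrite (mkseq_ends_with _ sN) act_list_cat //; last exact: allin_nseqR.
    apply: act_agree; rewrite /lo1 actR_iter_cons /b101 (catseq_cons true [:: false]).
    by apply: (agreeW _ (agree_catseq [:: true] (actR_iter k (zerosE 0)))); rewrite addnS ltnW.
  by rewrite leNgt b1.
split => //.
  apply: (act_lim_unique sS (@unboundedT _ sS prim false) (zerosE 0)) => n.
  exists n; split => //; have [wS [a1 a2] _] := IP n.
  by apply: sandwich (ltW a1) a2; exact: act_list_pfx.
apply: (act_lim_unique sS (@unboundedT _ sS prim true) (onesE 0)) => n.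
exists n; split => //; have [wS _ [b1 b2]] := IP n.
by apply: sandwich b1 (ltW b2); exact: act_list_pfx.
Qed.

(** Here [I] gives strict bounds, which exist at the start because a = 01^oo and b = 10^oo are
    separate alternatives. [J] records the opposite bound: on [b] after a step [L], on [a] after a
    step [R]. *)
Lemma exhaust_LR (a b : binseq) : a 0 = false -> b 0 = true ->
  [\/ exists2 w, allin LR w &
        (act (comp_list w) (act substM zeros) <= a /\
         b <= act (comp_list w) (act substM ones))%O,
      exists s : nat -> subst, [/\ range s `<=` LR, primitive s,
        a = act_lim s zeros & b = act_lim s ones],
      a = hi0 \/ b = lo1 |
      exists2 w, allin LR w &
       (a < act (comp_list w) (act substM zeros) /\
        act (comp_list w) (act substM lo1) <= b)%O \/
       (a <= act (comp_list w) (act substM hi0) /\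
        act (comp_list w) (act substM ones) < b)%O].
Proof.
move=> a0 b0; apply: contrapT => /not_or4[n1 n2 n3 n4].
pose I := [set w | [/\ allin LR w,
  (a < act (comp_list w) hi0)%O & (act (comp_list w) lo1 < b)%O]].
pose J w s := [/\ LR s,
  (s = substL -> b < act (comp_list (rcons w s)) b101)%O &
  (s = substR -> act (comp_list (rcons w s)) a010 < a)%O].
have LneR : substL <> substR by move=> /(congr1 (fun s : subst => s true)).
have [|w [wS ha hb]|s sP] := @directive_sequence I J.
- split => //; rewrite act_id.
    by rewrite lt_neqAle le_head0 // andbT; apply/eqP => e; apply: n3; left.
  by rewrite lt_neqAle ge_head1 // andbT; apply/eqP => e; apply: n3; right.
- have wS' := allin_LR wS.
  have LS : LMR substL by left; left.
  have RS : LMR substR by right.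
  case: (ltP a (act (comp_list w) (act substM zeros))) => ha'.
    exists substL; split; first split.
    + by apply: allin_rcons => //; left.
    + by rewrite act_rcons ?actL_hi0.
    + by rewrite act_rcons ?actL_lo1.
    split => [|_|/LneR//]; first by left.
    rewrite act_rcons // -actM_lo1 ltNge; apply/negP => h.
    by apply: n4; exists w => //; left.
  case: (leP b (act (comp_list w) (act substM ones))) => hb'.
    by exfalso; apply: n1; exists w.
  exists substR; split; first split.
  + by apply: allin_rcons => //; right.
  + by rewrite act_rcons ?actR_hi0.
  + by rewrite act_rcons ?actR_lo1.
  split => [|/esym/LneR//|_]; first by right.
  rewrite act_rcons // -actM_hi0 ltNge; apply/negP => h.
  by apply: n4; exists w => //; right.
have sS' n : LR (s n) by have [_ []] := sP n.
have sSR : range s `<=` LR by move=> _ [n _ <-].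
have sS : range s `<=` LMR by move=> _ [n _ <-]; exact: LR_LMR.
have IP n := (sP n).1.
have LP n : s n = substL -> (b < act (comp_list (mkseq s n.+1)) b101)%O.
  by move=> sn; rewrite mkseqS; have [_ [_ h _]] := sP n; exact: h.
have RP n : s n = substR -> (act (comp_list (mkseq s n.+1)) a010 < a)%O.
  by move=> sn; rewrite mkseqS; have [_ [_ _ h]] := sP n; exact: h.
apply: n2; exists s.
(* With a tail of [L] the bounds on [b] from [J] tend to w(10^oo), while [I] keeps [b] strictly
   above it. *)
have prim : primitive s.
  split=> -[N sN].
    have [/allin_LR wS _ b1] := IP N.
    suff : (b <= act (comp_list (mkseq s N)) lo1)%O by rewrite leNgt b1.
    apply: le_of_agree => k; have := LP (N + k) (sN _ (leq_addr _ _)).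
    exists b, (act (comp_list (mkseq s (N + k).+1)) b101); split => //; last exact: ltW.
    rewrite -addnS (mkseq_ends_with _ sN) act_list_cat //; last exact: allin_nseqL.
    apply: act_agree.
    apply: (agreeW _ (actL_iter k.+1 (erefl : b101 0 = true))); lia.
  have [/allin_LR wS a1 _] := IP N.
  suff : (act (comp_list (mkseq s N)) hi0 <= a)%O by rewrite leNgt a1.
  apply: le_of_agree => k; have := RP (N + k) (sN _ (leq_addr _ _)).
  exists (act (comp_list (mkseq s (N + k).+1)) a010), a; split => //; last exact: ltW.
  rewrite -addnS (mkseq_ends_with _ sN) act_list_cat //; last exact: allin_nseqR.
  apply: act_agree.
  apply: (agreeW _ (actR_iter k.+1 (erefl : a010 0 = false))); lia.
split => //.
  (* [a] is enclosed from both sides only after a step [R]; primitivity provides such steps beyond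
     every N. *)
  apply: (act_lim_unique sS (@unboundedT _ sS prim false) (zerosE 0)) => N.
  have [n Nn sn] := not_ends prim (or_introl erefl) N.
  exists n.+1; split; first exact: leqW.
  have [/allin_LR wS a2 _] := IP n.+1.
  have {}sn : s n = substR by case: (sS' n).
  by apply: sandwich (ltW (RP _ sn)) (ltW a2); exact: act_list_pfx.
apply: (act_lim_unique sS (@unboundedT _ sS prim true) (onesE 0)) => N.
have [n Nn sn] := not_ends prim (or_intror erefl) N.
exists n.+1; split; first exact: leqW.
have [/allin_LR wS _ b1] := IP n.+1.
have {}sn : s n = substL by case: (sS' n).
by apply: sandwich (ltW b1) (ltW (LP _ sn)); exact: act_list_pfx.
Qed.

(** * Counting blocks *)

Definition mktup (F : nat -> bool) n : n.-tuple bool := [tuple F i | i < n].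

Lemma val_mktup F n : mktup F n = mkseq F n :> seq bool.
Proof. by rewrite /= /mkseq -val_enum_ord -map_comp. Qed.

Lemma mem_blocks (X : set binseq) n (w : n.-tuple bool) :
  (w \in [pred w : n.-tuple bool | `[< is_block X w >]]) = `[< is_block X w >].
Proof. by []. Qed.

Lemma nb_blocks_gt0 (X : set binseq) n : X !=set0 -> 0 < nb_blocks X n.
Proof.
move=> [u Xu]; rewrite /nb_blocks; apply/card_gt0P; exists (mktup u n).
rewrite mem_blocks; apply: asboolT.
exists u => //; exists 0.
by rewrite val_mktup size_mkseq.
Qed.

Lemma nb_blocksD (X : set binseq) m n :
  nb_blocks X (m + n) <= nb_blocks X m * nb_blocks X n.
Proof.
rewrite /nb_blocks; set A := [pred w | _]; set B := [pred w | _]; set C := [pred w | _].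
pose f (t : (m + n).-tuple bool) :=
  (mktup (nth false t) m, mktup (fun i => nth false t (m + i)) n).
have finj : injective f.
  move=> t t' ft.
  have e1 : mkseq (nth false t) m = mkseq (nth false t') m.
    by rewrite -!val_mktup; congr (val _); exact: (congr1 fst ft).
  have e2 : mkseq (fun i => nth false t (m + i)) n = mkseq (fun i => nth false t' (m + i)) n.
    by rewrite -!val_mktup; congr (val _); exact: (congr1 snd ft).
  apply/val_inj/(@eq_from_nth _ false); first by rewrite !size_tuple.
  move=> i; rewrite size_tuple => imn; case: (ltnP i m) => im.
    by have := congr1 (nth false ^~ i) e1; rewrite !nth_mkseq.
  have imn' : i - m < n by move: im imn; clear; lia.
  by have := congr1 (nth false ^~ (i - m)) e2; rewrite !nth_mkseq // subnKC.
rewrite -(fintype.card_image finj) -cardX; apply: subset_leq_card.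
apply/fintype.subsetP => _ /fintype.imageP[t tA ->]; move: tA; rewrite /A mem_blocks => /asboolW[u Xu [k tE]].
rewrite size_tuple in tE; change ((mktup (nth false t) m \in B) && (mktup (fun i => nth false t (m + i)) n \in C)).
rewrite /B /C !mem_blocks; apply/andP; split; apply: asboolT.
  exists u => //; exists k; rewrite val_mktup size_mkseq tE; apply/agree_mkseq => i im.
  by rewrite nth_mkseq // ltn_addr.
exists u => //; exists (k + m); rewrite val_mktup size_mkseq tE; apply/agree_mkseq => i im.
by rewrite nth_mkseq ?ltn_add2l // /shiftseq addnA.
Qed.

Lemma catseq_sizeE w v n : catseq w v (size w + n) = v n.
Proof. by rewrite /catseq ltnNge leq_addr /= addKn. Qed.

(** The first letter is read off directly, and removing its image costs at most [C] letters. *)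
Lemma act_agree_inv s C q u v : head_preserving s -> (forall c, size (s c) <= C) ->
  agree (q * C) (act s u) (act s v) -> agree q u v.
Proof.
move=> sP sC; elim: q u v => [//|q IH] u v uv.
have C0 : 0 < C := leq_trans (hp_size sP false) (sC false).
have u0 : u 0 = v 0.
  by have := uv 0; rewrite !act_head //; apply; rewrite muln_gt0.
have /IH uv1 : agree (q * C) (act s (shiftseq 1 u)) (act s (shiftseq 1 v)).
  move=> i iC; have := uv (size (s (u 0)) + i).
  rewrite (act_unfold sP u) (act_unfold sP v) -u0 !catseq_sizeE.
  by apply; have := sC (u 0); move: iC; rewrite mulSn; clear; lia.
by move=> [|i] iq; [|exact: uv1].
Qed.

(** Words of length n/C are recovered from the first n letters of their images, so their images
    yield distinct blocks. *)
Lemma nb_blocks_exp (X : set binseq) s C n : head_preserving s ->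
  (forall c, size (s c) <= C) -> (forall u, X (act s u)) ->
  2 ^ (n %/ C) <= nb_blocks X n.
Proof.
move=> sP sC sX; set q := n %/ C.
pose f (t : q.-tuple bool) := mktup (act s (catseq t zeros)) n.
have finj : injective f.
  move=> t t' /(congr1 val); rewrite /= -/(val _) !val_mktup => /agree_mkseq e.
  have /(act_agree_inv sP sC)/agree_mkseq : agree (q * C) (act s (catseq t zeros)) (act s (catseq t' zeros)).
    by apply: agreeW e; exact: leq_trunc_div.
  have := pfx_mkseqE (pfx_catseq t zeros); have := pfx_mkseqE (pfx_catseq t' zeros).
  by rewrite !size_tuple => -> -> /val_inj.
have -> : 2 ^ q = #|{: q.-tuple bool}| by rewrite card_tuple card_bool.
rewrite -(fintype.card_image finj) /nb_blocks; apply: subset_leq_card.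
apply/fintype.subsetP => _ /fintype.imageP[t _ ->]; rewrite mem_blocks; apply: asboolT.
by exists (act s (catseq t zeros)) => //; exists 0; rewrite val_mktup size_mkseq.
Qed.

(* The beginnings of elements obtained by desubstituting along [w]: for blocks of length [N]
   the exponent [j] of the leading [c^j] may be truncated to [N]. *)
Fixpoint encode N (w : seq subst) (cs : seq ('I_N.+1 * bool)) (t : seq bool) : seq bool :=
  if w is s :: w' then
    let jc := head (ord0, false) cs in
    nseq jc.1 jc.2 ++ act_word s (encode w' (behead cs) t)
  else t.

Lemma encode_suffix N w (cs : seq ('I_N.+1 * bool)) t :
  exists x, encode w cs t = x ++ act_word (comp_list w) t.
Proof.
elim: w cs => [|s w IH] cs; first by exists [::]; rewrite act_word_id.
have [x xE] := IH (behead cs); rewrite /= xE act_word_cat -act_word_comp catA.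
by eexists.
Qed.

Lemma pfx_take N w u : pfx w u -> pfx (take N w) u.
Proof. by move=> wu; apply: (@pfx_cat _ (drop N w)); rewrite cat_take_drop. Qed.

(** Images are never shorter than words, so truncating a word to [N] letters does not affect the
    first [N] letters of its image. *)
Lemma act_pfx_take N s w v i : head_preserving s -> pfx (take N w) v -> i < N ->
  i < size (act_word s w) -> act s v i = nth false (act_word s w) i.
Proof.
move=> sP /(act_pfx sP) wv iN; rewrite -(cat_take_drop N w) act_word_cat nth_cat => iw.
case: ltnP => iw'; first by rewrite wv.
have := leq_trans (size_act_word sP _) iw'; rewrite size_take.
case: ltnP => Nw; first by rewrite leqNgt iN.
by move: iw iw'; rewrite drop_oversize // cats0 => iw; rewrite leqNgt iw.
Qed.

Lemma encode_pfx N w P Q u m : allin LMR w ->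
  (forall x, P x -> (x <= act (comp_list w) hi0)%O) ->
  (forall x, Q x -> (act (comp_list w) lo1 <= x)%O) -> OmPQ P Q u ->
  exists cs : (size w).-tuple ('I_N.+1 * bool), exists t : m.-tuple bool,
    pfx (take N (encode w cs t)) u.
Proof.
elim: w P Q u => [|s w IH] P Q u.
  move=> _ _ _ _; exists [tuple], (mktup u m); apply: pfx_take; rewrite val_mktup.
  exact: pfx_mkseq.
move=> /allin_cons[sS wS] PM QM uO; have sP := hp_LMR sS; have wP := hp_list wS.
have const c : u = (fun _ => c) -> exists cs : (size (s :: w)).-tuple ('I_N.+1 * bool),
    exists t : m.-tuple bool, pfx (take N (encode (s :: w) cs t)) u.
  (* A run of length [N] already fills the visible part; the remaining entries are arbitrary
     fillers. *)
  move=> ->; exists [tuple of (ord_max, c) :: nseq (size w) (ord_max, c)], [tuple of nseq m c].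
  by rewrite /= take_cat size_nseq ltnn subnn take0 cats0 => i; rewrite size_nseq nth_nseq => ->.
have {}PM x : P x -> (x <= act s (act (comp_list w) hi0))%O by move=> /PM; rewrite act_comp.
have {}QM x : Q x -> (act s (act (comp_list w) lo1) <= x)%O by move=> /QM; rewrite act_comp.
have [x /PM/le_trans -> //|x /QM h|uE|uE|[c [j [v [uE vO]]]]] := desubst sS _ _ uO.
- by rewrite act_leE //; exact: list_hi0.
- by apply: le_trans h; rewrite act_leE //; exact: list_lo1.
- by apply: (const false); rewrite uE; apply/funext => n; rewrite zerosE.
- by apply: (const true); rewrite uE; apply/funext => n; rewrite onesE.
have [||cs [t pv]] := IH (act s @^-1` P) (act s @^-1` Q) v wS _ _ vO.
- by move=> x /PM; rewrite act_leE.
- by move=> x /QM; rewrite act_leE.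
have jN : minn j N < N.+1 by rewrite ltnS geq_minr.
exists [tuple of (Ordinal jN, c) :: cs], t => i /=; set E := encode w cs t in pv *.
rewrite size_take_min size_cat size_nseq => iN; have iN' : i < N by move: iN; lia.
rewrite nth_take // nth_cat size_nseq; case: ltnP => ij.
  rewrite nth_nseq ij uE /catseq size_nseq nth_nseq; have -> // : i < j by move: ij; lia.
have jE : minn j N = j by move: ij iN'; lia.
rewrite jE in ij iN *; rewrite uE /catseq size_nseq ltnNge ij /=.
by rewrite (act_pfx_take (N := N) (w := E)) //; move: iN iN' ij; lia.
Qed.

(** Every block of length [N] is determined by its code: one truncated exponent and one letter for
    each substitution, then [m] letters whose images alone have length at least m l >= N. For fixed
    [w] the first factor is polynomial in [N]. *)
Lemma nb_blocks_le N w P Q m l : allin LMR w ->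
  (forall x, P x -> (x <= act (comp_list w) hi0)%O) ->
  (forall x, Q x -> (act (comp_list w) lo1 <= x)%O) ->
  (forall c, l <= size (comp_list w c)) -> N <= m * l ->
  nb_blocks (OmPQ P Q) N <= (N.+1 * 2) ^ size w * 2 ^ m.
Proof.
move=> wS PM QM wl Nml.
pose f (p : (size w).-tuple ('I_N.+1 * bool) * m.-tuple bool) :=
  mktup (nth false (encode w p.1 p.2)) N.
have szE (p : (size w).-tuple ('I_N.+1 * bool) * m.-tuple bool) :
    N <= size (encode w p.1 p.2).
  have [x ->] := encode_suffix w p.1 p.2; rewrite size_cat.
  have szw (t : seq bool) : size t * l <= size (act_word (comp_list w) t).
    elim: t => //= c t IH; rewrite act_word_cons size_cat mulSn; exact: leq_add.
  by have := szw p.2; rewrite size_tuple; move: Nml; lia.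
rewrite /nb_blocks.
have -> : (N.+1 * 2) ^ size w * 2 ^ m =
    #|{: (size w).-tuple ('I_N.+1 * bool) * m.-tuple bool}|.
  by rewrite card_prod !card_tuple card_prod card_ord card_bool.
apply: leq_trans (leq_image_card f predT); apply: subset_leq_card.
apply/fintype.subsetP => b; rewrite mem_blocks => /asboolW[u uO [k bE]]; rewrite size_tuple in bE.
have [cs [t pE]] := encode_pfx N m wS PM QM (OmPQ_shift k uO).
apply/fintype.imageP; exists (cs, t) => //; apply/val_inj; rewrite /= -/(val (mktup _ _)) val_mktup.
rewrite bE; apply/agree_mkseq => i iN; have := szE (cs, t) => /= sz.
by rewrite pE ?size_takel // nth_take.
Qed.

(** * Entropy *)

Section Entropy.
Variable R : realType.
Local Open Scope ring_scope.

(* Fekete's lemma: the quotients converge to their infimum. *)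
Lemma cvg_subadditive (f : nat -> R) : (forall n, 0 <= f n) ->
  (forall m n, f (m + n)%N <= f m + f n) -> cvgn (fun n => f n / n%:R).
Proof.
move=> f0 fD; pose E := [set f n / n%:R | n in [set n | (0 < n)%N]].
have lbE : lbound E 0 by move=> _ [n n0 <-]; rewrite divr_ge0.
have hE : has_inf E by split; [exists (f 1%N / 1%:R); exists 1%N|exists 0].
have fM q m r : f (q * m + r)%N <= q%:R * f m + f r.
  elim: q => [|q IH]; first by rewrite mul0r !add0r.
  rewrite mulSn -addnA; apply: le_trans (fD _ _) _.
  by rewrite -natr1 mulrDl mul1r [q%:R * _ + _]addrC -addrA lerD2l.
apply/cvg_ex; exists (inf E); apply/cvgrPdist_le => e e0.
have e2 : 0 < e / 2 by rewrite divr_gt0.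
have [_ [m m0 <-] hm] := inf_adherent e2 hE.
pose K := \sum_(r < m) f r.
have fK r : (r < m)%N -> f r <= K.
  by move=> rm; rewrite /K (bigD1 (Ordinal rm)) //= lerDl sumr_ge0.
near=> n.
have n0 : (0 < n)%N by near: n; exact: nbhs_infty_gt.
have nK : K / (e / 2) <= n%:R by near: n; exact: nbhs_infty_ger.
have n0' : 0 < n%:R :> R by rewrite ltr0n.
have m0' : 0 < m%:R :> R by rewrite ltr0n.
have lfn : inf E <= f n / n%:R by apply: ge_inf; [exists 0|exists n].
have fn : f n <= n%:R * (f m / m%:R) + K.
  rewrite {1}(divn_eq n m); apply: le_trans (fM _ _ _) _; apply: lerD; last first.
    by apply: fK; rewrite ltn_pmod.
  have -> : (n %/ m)%:R * f m = (n %/ m * m)%:R * (f m / m%:R) :> R.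
    by rewrite natrM -mulrA; congr (_ * _); rewrite mulrCA divff ?mulr1 // gt_eqF.
  by apply: ler_wpM2r; rewrite ?divr_ge0 // ler_nat leq_trunc_div.
have fn' : f n / n%:R <= f m / m%:R + e / 2.
  rewrite ler_pdivrMr // mulrDl mulrC; apply: le_trans fn _; rewrite lerD //.
  by move: nK; rewrite ler_pdivrMr // mulrC.
rewrite distrC ger0_norm ?subr_ge0 // lerBlDr.
apply: le_trans fn' _; rewrite [leRHS](_ : _ = inf E + e / 2 + e / 2); last by lra.
by rewrite lerD2r ltW // addrC.
Unshelve. all: by end_near.
Qed.

Lemma ln_nb_blocks_ge0 (X : set binseq) n : X !=set0 -> 0 <= ln (nb_blocks X n)%:R :> R.
Proof. by move=> X0; apply: ln_ge0; rewrite ler1n nb_blocks_gt0. Qed.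

Lemma entropy_gt0 (X : set binseq) s : head_preserving s -> (forall u, X (act s u)) ->
  0 < entropy R X.
Proof.
move=> sP sX; have X0 : X !=set0 by exists (act s zeros).
have nb0 n : (0 : R) < (nb_blocks X n)%:R by rewrite ltr0n nb_blocks_gt0.
pose C := maxn (size (s false)) (size (s true)).
have sC c : (size (s c) <= C)%N by case: c; rewrite /C leq_max leqnn ?orbT.
have C0 : (0 < C)%N := leq_trans (hp_size sP false) (sC false).
have C0' : 0 < C%:R :> R by rewrite ltr0n.
have l2 : 0 < ln (2 : R) by rewrite ln_gt0 // ltr1n.
(* The factor 2 absorbs the rounding in n/C, as n <= 2 C (n/C) once n >= C. *)
apply: (@lt_le_trans _ _ (ln 2 / (2 * C%:R))); first by rewrite divr_gt0 // mulr_gt0.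
apply: limr_ge.
  apply: (@cvg_subadditive (fun n => ln (nb_blocks X n)%:R)).
    by move=> n; exact: ln_nb_blocks_ge0.
  move=> m n; rewrite -lnM ?posrE // ler_ln ?posrE // ?mulr_gt0 //.
  by rewrite -natrM ler_nat nb_blocksD.
near=> n.
have nC : (C <= n)%N by near: n; exact: nbhs_infty_ge.
have n0 : 0 < n%:R :> R by rewrite ltr0n (leq_trans C0).
rewrite ler_pdivlMr //; apply: (@le_trans _ _ ((n %/ C)%:R * ln 2)).
  rewrite mulrAC ler_pdivrMr ?mulr_gt0 // mulrC -mulrA (mulrC (ln 2)) mulrA.
  apply: ler_wpM2r; first exact: ltW.
  rewrite -natrM -natrM ler_nat; have := ltn_ceil n C0.
  have : (0 < n %/ C)%N by rewrite divn_gt0.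
  by clear; nia.
rewrite mulr_natl -lnXn // ler_ln ?posrE ?exprn_gt0 //.
by rewrite -natrX ler_nat (nb_blocks_exp n sP sC sX).
Unshelve. all: by end_near.
Qed.

(** ln x = 2 ln(sqrt x) <= 2 sqrt x with x = 2(N+1) <= 4N; any explicit sublinear bound would do to
    neutralize the polynomial factor. *)
Lemma ln_le_sqrt (N : nat) : (0 < N)%N -> ln (N.+1 * 2)%:R <= 4 * Num.sqrt N%:R :> R.
Proof.
move=> N0; set x : R := (N.+1 * 2)%:R.
have x0 : 0 < x by rewrite ltr0n muln_gt0.
have sx : 0 < Num.sqrt x by rewrite sqrtr_gt0.
rewrite -(sqr_sqrtr (ltW x0)) lnXn // -mulr_natl.
have h1 : ln (Num.sqrt x) <= Num.sqrt x by apply: ltW; exact: ln_sublinear.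
have h2 : Num.sqrt x <= 2 * Num.sqrt N%:R.
  have -> : 2 * Num.sqrt N%:R = Num.sqrt (2 ^+ 2 * N%:R) :> R.
    by rewrite sqrtrM ?sqr_ge0 // sqrtr_sqr ger0_norm.
  by rewrite ler_wsqrtr // -natrX -natrM ler_nat; move: N0; clear; lia.
lra.
Qed.

(** The exponent [k] depends on [l] but not on [N], so the polynomial factor vanishes in the limit
    and a rate of about ln 2 / l remains, for every [l]. *)
Lemma entropy_eq0 (X : set binseq) : X !=set0 ->
  (forall l, exists k, forall N m, (N <= m * l)%N ->
     (nb_blocks X N <= (N.+1 * 2) ^ k * 2 ^ m)%N) ->
  entropy R X = 0.
Proof.
move=> X0 H; apply: cvg_lim => //; apply/cvgr0Pnorm_le => e e0.
(* The error e N is split into three: 4 k sqrt N from the polynomial factor, N/l from the free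
   letters, and 1 from rounding [m] up. This dictates l > 3/e, N >= (12k/e)^2 and N >= 3/e. *)
pose l := (Num.truncn (3 / e)).+1; have [k kP] := H l.
have l0 : 0 < l%:R :> R by rewrite ltr0n.
have le : 3 <= e * l%:R.
  have : 3 / e < l%:R by exact: truncnS_gt.
  by rewrite ltr_pdivrMr // mulrC => /ltW.
near=> N.
have N0 : (0 < N)%N by near: N; exact: nbhs_infty_gt.
have Nk : (12 * k%:R / e) ^+ 2 <= N%:R by near: N; exact: nbhs_infty_ger.
have Ne : 3 / e <= N%:R by near: N; exact: nbhs_infty_ger.
have N0' : 0 < N%:R :> R by rewrite ltr0n.
rewrite ger0_norm ?divr_ge0 ?ln_nb_blocks_ge0 // ler_pdivrMr //.
pose m := (N %/ l).+1.
have Nm : (N <= m * l)%N by apply: ltnW; exact: ltn_ceil.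
have b1 : ln (nb_blocks X N)%:R <= k%:R * ln (N.+1 * 2)%:R + m%:R * ln 2 :> R.
  rewrite !mulr_natl -!lnXn ?ltr0n ?muln_gt0 // -lnM ?posrE ?exprn_gt0 ?ltr0n ?muln_gt0 //.
  rewrite ler_ln ?posrE ?mulr_gt0 ?exprn_gt0 ?ltr0n ?muln_gt0 ?nb_blocks_gt0 //.
  by rewrite -!natrX -natrM ler_nat kP.
set y := Num.sqrt (N%:R : R).
have y0 : 0 < y by rewrite sqrtr_gt0.
have yy : y * y = N%:R by rewrite -expr2 sqr_sqrtr // ltW.
have yk : 12 * k%:R <= e * y.
  have : 12 * k%:R / e <= y.
    have h : 0 <= 12 * k%:R / e by rewrite divr_ge0 // ?mulr_ge0 // ltW.
    by rewrite -(ger0_norm h) -sqrtr_sqr ler_wsqrtr.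
  by rewrite ler_pdivrMr // (mulrC y).
have b2 : k%:R * ln (N.+1 * 2)%:R <= k%:R * (4 * y) :> R.
  by apply: ler_wpM2l; rewrite ?ler0n ?ln_le_sqrt.
have b3 : k%:R * (4 * y) <= e * N%:R / 3.
  have : 12 * k%:R * y <= e * y * y by rewrite ler_wpM2r // ltW.
  rewrite -(mulrA e) yy; lra.
have ln2 : ln (2 : R) <= 1.
  by have := @le_ln1Dx R 1; rewrite -natr1 addrC => -> //; rewrite ltrN10.
have b4 : m%:R * ln 2 <= m%:R :> R by rewrite ler_piMr.
have b5 : m%:R <= e * N%:R / 3 + 1 :> R.
  have -> : m%:R = (N %/ l)%:R + 1 :> R by rewrite natr1.
  rewrite lerD2r ler_pdivlMr //.
  have : ((N %/ l)%:R * l%:R : R) <= N%:R by rewrite -natrM ler_nat leq_trunc_div.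
  have : ((N %/ l)%:R : R) * 3 <= (N %/ l)%:R * (e * l%:R) by rewrite ler_wpM2l.
  move=> h1 /(ler_wpM2l (ltW e0)) h2; apply: le_trans h1 _; rewrite mulrCA; exact: h2.
have b6 : 3 <= e * N%:R by move: Ne; rewrite ler_pdivrMr // mulrC.
lra.
Unshelve. all: by end_near.
Qed.

End Entropy.

(** * Consequences for [Omega]: trivial, countable, full and limit cases *)

Lemma Omega_flip (a b u : binseq) : Omega a b u -> Omega (flip b) (flip a) (flip u).
Proof.
by move=> uO k; have [h|h] := uO k; [right|left]; rewrite -flip_shift flip_le.
Qed.

Lemma zeros_Omega (a b : binseq) : Omega a b zeros.
Proof.
move=> k; left; have -> : shiftseq k zeros = zeros.
  by apply/funext => n; rewrite /shiftseq !zerosE.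
exact: zeros_le.
Qed.

Lemma ones_Omega (a b : binseq) : Omega a b ones.
Proof. by rewrite -(flipK a) -(flipK b) -flip_zeros; exact/Omega_flip/zeros_Omega. Qed.

Lemma Omega_trivial_lt w (a b : binseq) : a 0 = false -> b 0 = true -> allin LR w ->
  (a < act (comp_list w) (act substM zeros))%O ->
  (act (comp_list w) (act substM lo1) <= b)%O ->
  Omega a b `<=` [set zeros; ones].
Proof.
move=> a0 b0 wS ha hb u; rewrite Omega_OmPQ //; apply: (trivial_OmPQ wS) => x /= h.
  exact: le_lt_trans h ha.
exact: le_trans hb h.
Qed.

Lemma Omega_trivial w (a b : binseq) : a 0 = false -> b 0 = true -> allin LR w ->
  (a < act (comp_list w) (act substM zeros) /\
   act (comp_list w) (act substM lo1) <= b)%O \/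
  (a <= act (comp_list w) (act substM hi0) /\
   act (comp_list w) (act substM ones) < b)%O ->
  Omega a b = [set zeros; ones].
Proof.
move=> a0 b0 wS H; apply/seteqP; split; last first.
  by move=> _ [->|->]; [exact: zeros_Omega|exact: ones_Omega].
case: H => [[ha hb]|[ha hb]]; first exact: Omega_trivial_lt ha hb.
move=> u /Omega_flip uO; have wS' := allin_LR wS.
have : [set zeros; ones] (flip u).
  apply: (@Omega_trivial_lt (map flip_subst w)) uO.
  - by rewrite /flip b0.
  - by rewrite /flip a0.
  - exact: allin_flip LR_flip wS.
  - rewrite -flip_ones -flip_substM act_flip_subst; last exact: hp_M.
    by rewrite act_flip_list // flip_lt.
  - rewrite -flip_hi0 -flip_substM act_flip_subst; last exact: hp_M.
    by rewrite act_flip_list // flip_le.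
move=> [] /(congr1 flip); rewrite flipK => ->; first by right; rewrite flip_zeros.
by left; rewrite flip_ones.
Qed.

Lemma Omega_countable_lo1 w (a b : binseq) : a 0 = false -> b 0 = true -> allin LMR w ->
  (a <= act (comp_list w) a010)%O -> (act (comp_list w) lo1 <= b)%O ->
  countable (Omega a b).
Proof.
move=> a0 b0 wS ha hb; rewrite Omega_OmPQ //; apply: (countable_OmPQ wS) => x /= h.
  exact: le_trans h ha.
exact: le_trans hb h.
Qed.

Lemma Omega_countable w (a b : binseq) : a 0 = false -> b 0 = true -> allin LMR w ->
  (a <= act (comp_list w) a010 /\ act (comp_list w) lo1 <= b)%O \/
  (a <= act (comp_list w) hi0 /\ act (comp_list w) b101 <= b)%O ->
  countable (Omega a b).
Proof.
move=> a0 b0 wS [[ha hb]|[ha hb]]; first exact: Omega_countable_lo1 ha hb.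
have c : countable (Omega (flip b) (flip a)).
  apply: (@Omega_countable_lo1 (map flip_subst w)).
  - by rewrite /flip b0.
  - by rewrite /flip a0.
  - exact: allin_flip LMR_flip wS.
  - have -> : a010 = flip b101 by rewrite /b101 flip_catseq flip_ones.
    by rewrite act_flip_list // flip_le.
  - by rewrite -flip_hi0 act_flip_list // flip_le.
apply: sub_countable (sub_countable (card_image_le flip _) c); apply: subset_card_le => u uO.
by exists (flip u); [exact: Omega_flip|exact: flipK].
Qed.

Lemma Omega_full (R : realType) v (a b : binseq) : allin LMR v ->
  (act (comp_list v) hi0 <= a)%O -> (b <= act (comp_list v) lo1)%O ->
  ~ countable (Omega a b) /\ (0 < entropy R (Omega a b))%R.
Proof.
move=> vS ha hb; have H u := full_image_Omega u vS ha hb.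
split; first exact: uncountable_image (hp_list vS) H.
exact: entropy_gt0 (hp_list vS) H.
Qed.

(** Every finite beginning of the directive sequence can be desubstituted, and primitivity makes its
    letter images as long as desired. *)
Lemma entropy_lim (R : realType) s : range s `<=` LMR -> primitive s ->
  entropy R (Omega (act_lim s zeros) (act_lim s ones)) = 0%R.
Proof.
move=> sS prim; apply: entropy_eq0; first by exists zeros; exact: zeros_Omega.
have h0 : act_lim s zeros 0 = false.
  have := @act_lim_pfx _ sS _ _ (@unboundedT _ sS prim false) (zerosE 0) 0.
  by move=> /(_ 0 (hp_size (hp_mkseq sS 0) false)) ->.
have h1 : act_lim s ones 0 = true.
  have := @act_lim_pfx _ sS _ _ (@unboundedT _ sS prim true) (onesE 0) 0.
  by move=> /(_ 0 (hp_size (hp_mkseq sS 0) true)) ->.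
move=> l; have [n nl] := primitive_size sS prim l; exists n => N m Nm.
rewrite Omega_OmPQ // -[X in _ ^ X](size_mkseq s n).
apply: nb_blocks_le Nm => [|x /= h|x /= h|c]; first exact: allin_mkseq.
- exact: le_trans h (act_lim_le sS prim erefl n).
- exact: le_trans (act_lim_ge sS prim erefl n) h.
- exact: nl.
Qed.

(** The sequence 01^oo meets its own bound, and its proper tails 1^oo lie above every [b]. *)
Lemma hi0_Omega b : b 0 = true -> Omega hi0 b hi0.
Proof.
move=> b0 [|k]; first by left; exact: lexx.
right; have -> : shiftseq k.+1 hi0 = ones.
  by apply/funext => n; rewrite /shiftseq addSn /hi0 catseqS catseq_nil !onesE.
exact: le_ones.
Qed.

Lemma hi0_nontrivial b : b 0 = true -> Omega hi0 b <> [set zeros; ones].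
Proof.
move=> /hi0_Omega + e; rewrite e => -[|] /(congr1 (fun u : binseq => (u 0, u 1))).
  by rewrite !zerosE.
by rewrite !onesE.
Qed.

Lemma lo1_nontrivial a : a 0 = false -> Omega a lo1 <> [set zeros; ones].
Proof.
move=> a0 e; have : Omega a lo1 lo1.
  rewrite -(flipK a) -(flipK lo1) flip_lo1; apply: Omega_flip.
  by apply: hi0_Omega; rewrite /flip a0.
rewrite e => -[|] /(congr1 (fun u : binseq => (u 0, u 1))).
  by rewrite !zerosE.
by rewrite !onesE.
Qed.

(** * Translation to monoids of substitutions and the five equivalences *)

Lemma monoid_gen_compE S w t : allin S w ->
  monoid_gen_comp S t (subst_comp (comp_list w) t).
Proof. by move=> wS; exists (comp_list w) => //; exists w. Qed.

Lemma act_list_M w u : allin LMR w ->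
  act (subst_comp (comp_list w) substM) u = act (comp_list w) (act substM u).
Proof. by move=> wS; rewrite act_comp //; [exact: hp_list|exact: hp_M]. Qed.

Local Open Scope classical_set_scope.
Local Open Scope order_scope.

Theorem theorem4 (R : realType) (a b : binseq)
    (ha : a 0%N = false) (hb : b 0%N = true) :
  [/\ (* (i) *)
      Omega a b <> [set zeros; ones] <->
      [\/ exists s, [/\ monoid_gen_comp [set substL; substR] substM s,
            act s zeros <= a & b <= act s ones],
          exists s : nat -> subst,
            [/\ range s `<=` [set substL; substR], primitive s,
            a = act_lim s zeros & b = act_lim s ones],
          a = catseq [:: false] ones |
          b = catseq [:: true] zeros],
      (* (ii) *)
      Omega a b = [set zeros; ones] <->
      exists2 s, monoid_gen_comp [set substL; substR] substM s &
        (a < act s zeros /\ act s (catseq [:: true] zeros) <= b) \/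
        (a <= act s (catseq [:: false] ones) /\ act s ones < b),
      (* (iii) *)
      ~ countable (Omega a b) /\ (0 < entropy R (Omega a b))%R <->
      exists2 s, monoid_gen_comp [set substL; substM; substR] substM s &
        (act s zeros <= a /\ b < act s (catseq [:: true] zeros)) \/
        (act s (catseq [:: false] ones) < a /\ b <= act s ones),
      (* (iv) *)
      ~ countable (Omega a b) /\ entropy R (Omega a b) = 0%R <->
      exists s : nat -> subst,
        [/\ range s `<=` [set substL; substM; substR], primitive s,
            a = act_lim s zeros & b = act_lim s ones]
    & (* (v) *)
      countable (Omega a b) <->
      exists2 s, monoid_gen [set substL; substM; substR] s &
        (a <= act s (catseq [:: false; true] zeros) /\
           act s (catseq [:: true] zeros) <= b) \/
        (a <= act s (catseq [:: false] ones) /\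
           act s (catseq [:: true; false] ones) <= b)].
Proof.
have trivI : (exists2 s, monoid_gen_comp [set substL; substR] substM s &
        (a < act s zeros /\ act s (catseq [:: true] zeros) <= b) \/
        (a <= act s (catseq [:: false] ones) /\ act s ones < b)) ->
    Omega a b = [set zeros; ones].
  move=> [_ [_ [w wS <-] <-]]; rewrite !act_list_M; try exact: allin_LR.
  exact: Omega_trivial.
have ntrivI : [\/ exists s, [/\ monoid_gen_comp [set substL; substR] substM s,
            act s zeros <= a & b <= act s ones],
          exists s : nat -> subst,
            [/\ range s `<=` [set substL; substR], primitive s,
            a = act_lim s zeros & b = act_lim s ones],
          a = catseq [:: false] ones |
          b = catseq [:: true] zeros] -> Omega a b <> [set zeros; ones].
  move=> [[_ [[_ [w wS <-] <-]]]|[s [sS prim aE bE]]|->|->].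
  - rewrite !act_list_M; try exact: allin_LR.
    by apply: OmExt_nontrivial; exact: allin_LR.
  - move=> e; have sS' : range s `<=` LMR by move=> t /sS; exact: LR_LMR.
    by apply: (uncountable_lim sS' prim aE bE); rewrite e; exact: countable_const.
  - exact: hi0_nontrivial.
  - exact: lo1_nontrivial.
have exhLR : [\/ exists s, [/\ monoid_gen_comp [set substL; substR] substM s,
            act s zeros <= a & b <= act s ones],
          exists s : nat -> subst,
            [/\ range s `<=` [set substL; substR], primitive s,
            a = act_lim s zeros & b = act_lim s ones],
          a = catseq [:: false] ones |
          b = catseq [:: true] zeros] \/ (exists2 s, monoid_gen_comp [set substL; substR] substM s &
        (a < act s zeros /\ act s (catseq [:: true] zeros) <= b) \/
        (a <= act s (catseq [:: false] ones) /\ act s ones < b)).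
  have [[w wS [h1 h2]]|h|[->|->]|[w wS h]] := exhaust_LR ha hb.
  - left; apply: Or41; exists (subst_comp (comp_list w) substM).
    by rewrite !act_list_M; try exact: allin_LR; split => //; exact: monoid_gen_compE.
  - by left; apply: Or42.
  - by left; apply: Or43.
  - by left; apply: Or44.
  - right; exists (subst_comp (comp_list w) substM); first exact: monoid_gen_compE.
    by rewrite !act_list_M; try exact: allin_LR.
have posI : (exists2 s, monoid_gen_comp [set substL; substM; substR] substM s &
        (act s zeros <= a /\ b < act s (catseq [:: true] zeros)) \/
        (act s (catseq [:: false] ones) < a /\ b <= act s ones)) ->
    ~ countable (Omega a b) /\ (0 < entropy R (Omega a b))%R.
  move=> [_ [_ [w wS <-] <-]]; rewrite !act_list_M // => -[[h1 h2]|[h1 h2]].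
    by have [v vS [v1 v2]] := full_image_of_lt wS h1 h2; exact: Omega_full vS v1 v2.
  by have [v vS [v1 v2]] := full_image_of_gt wS h1 h2; exact: Omega_full vS v1 v2.
have zeroI : (exists s : nat -> subst,
        [/\ range s `<=` [set substL; substM; substR], primitive s,
            a = act_lim s zeros & b = act_lim s ones]) ->
    ~ countable (Omega a b) /\ entropy R (Omega a b) = 0%R.
  move=> [s [sS prim aE bE]]; split; first by apply: (uncountable_lim (s := s)).
  by rewrite aE bE; exact: entropy_lim.
have cntI : (exists2 s, monoid_gen [set substL; substM; substR] s &
        (a <= act s (catseq [:: false; true] zeros) /\
           act s (catseq [:: true] zeros) <= b) \/
        (a <= act s (catseq [:: false] ones) /\
           act s (catseq [:: true; false] ones) <= b)) -> countable (Omega a b).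
  by move=> [_ [w wS <-]]; exact: Omega_countable.
have exhLMR : [\/ exists2 s, monoid_gen_comp [set substL; substM; substR] substM s &
        (act s zeros <= a /\ b < act s (catseq [:: true] zeros)) \/
        (act s (catseq [:: false] ones) < a /\ b <= act s ones),
      exists s : nat -> subst,
        [/\ range s `<=` [set substL; substM; substR], primitive s,
            a = act_lim s zeros & b = act_lim s ones] |
      exists2 s, monoid_gen [set substL; substM; substR] s &
        (a <= act s (catseq [:: false; true] zeros) /\
           act s (catseq [:: true] zeros) <= b) \/
        (a <= act s (catseq [:: false] ones) /\
           act s (catseq [:: true; false] ones) <= b)].
  have [[w wS h]|h|[w wS h]] := exhaust_LMR ha hb.
  - apply: Or31; exists (subst_comp (comp_list w) substM); first exact: monoid_gen_compE.
    by rewrite !act_list_M.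
  - exact: Or32.
  - by apply: Or33; exists (comp_list w) => //; exists w.
split; split => //.
- by move=> h; case: exhLR => // /trivI.
- by move=> h; case: exhLR => // /ntrivI.
- move=> [h1 h2]; case: exhLMR => // [/zeroI[_ e]|/cntI //].
  by rewrite e ltxx in h2.
- move=> [h1 h2]; case: exhLMR => // [/posI[_ e]|/cntI //].
  by rewrite h2 ltxx in e.
- by move=> h; case: exhLMR => // [/posI[]|/zeroI[]].
Qed.
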